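(* Any regular, normal parabolic geometry $(\mathcal G\to M,\omega)$ of type $(G,P)=(G_2,P_1)$ has curvature function $\kappa$ valued in the curvature module $\mathbb E$. In particular, (a) $\kappa$ is torsion-free, i.e. valued in $\bigwedge^2(\mathfrak g/\mathfrak p)^*\otimes\mathfrak p$, and (b) $\kappa(x,y)=0$ for all $x,y\in\mathfrak g^{-2}/\mathfrak p$.
   Context: **$G_2$ data.** $\mathfrak g$ is the complex simple Lie algebra of type $G_2$, realised (with commutator bracket $[\cdot,\cdot]$) as the set of matrices $$\begin{pmatrix} 2z_1+z_2&b_{10}&b_{11}&\sqrt2 b_{21}&b_{31}&b_{32}&0\\ a_{10}&z_1+z_2&b_{01}&\sqrt2 b_{11}&-b_{21}&0&-b_{32}\\ a_{11}&a_{01}&z_1&-\sqrt2 b_{10}&0&b_{21}&-b_{31}\\ \sqrt2a_{21}&\sqrt2a_{11}&-\sqrt2a_{10}&0&\sqrt2b_{10}&-\sqrt2b_{11}&-\sqrt2b_{21}\\ a_{31}&-a_{21}&0&\sqrt2a_{10}&-z_1&-b_{01}&-b_{11}\\ a_{32}&0&a_{21}&-\sqrt2a_{11}&-a_{01}&-z_1-z_2&-b_{10}\\ 0&-a_{32}&-a_{31}&-\sqrt2a_{21}&-a_{11}&-a_{10}&-2z_1-z_2\end{pmatrix}$$ (over $\mathbb R$ use the split real form, i.e. real parameters). $\mathsf Z_i$, $f_{st}$, $e_{st}$ denote the matrices for which $z_i$, $a_{st}$, $b_{st}$ respectively equals $1$ and all other parameters vanish. $\mathfrak g=\bigoplus_{k=-3}^3\mathfrak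 g_k$ is the grading by eigenvalues of $\mathrm{ad}_{\mathsf Z_1}$; $\mathfrak g^i=\bigoplus_{j\ge i}\mathfrak g_j$, $\mathfrak p=\mathfrak g^0$, $\mathfrak p_+=\mathfrak g^1$; $P=P_1$ is the parabolic subgroup with Lie algebra $\mathfrak p$ (taken as the connected subgroup of $\mathrm{Aut}(\mathfrak g)$). **Cartan geometry.** A Cartan geometry of type $(G,P)$ is a right $P$-principal bundle $\mathcal G\to M$ with $\omega\in\Omega^1(\mathcal G;\mathfrak g)$ such that each $\omega_u:T_u\mathcal G\to\mathfrak g$ is a linear isomorphism, $R_p^*\omega=\mathrm{Ad}_{p^{-1}}\omega$ for $p\in P$, and $\omega(X^\dagger)=X$ for the fundamental vertical fields $X^\dagger$, $X\in\mathfrak p$. Its curvature $K=d\omega+\frac12[\omega,\omega]$ is horizontal and yields the curvature function $\kappa:\mathcal G\to\bigwedge^2(\mathfrak g/\mathfrak p)^*\otimes\mathfrak g$, $\kappa(x,y)=K(\omega^{-1}(x),\omega^{-1}(y))$. The Killing form gives $(\mathfrak g/\mathfrak p)^*\cong\mathfrak p_+$. With $\partial^*(X\wedge Y\otimes v)=-Y\otimes[X,v]+X\otimes[Y,v]-[X,Y]\otimes v$ on $\bigwedge^2\mathfrak p_+\otimes\mathfrak g$, let $\ker(\partial^* )^1$ be the subspace of $\ker\partial^*$ on which $\mathsf Z_1$ acts with positive eigenvalues. The geometry is regular and normal if $\kappa$ is valued in $\ker(\partial^* )^1$. **Curvature module.** $\mathbb E\subset\ker(\partial^* )^1$ is the $P$-submodule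 of $\bigwedge^2\mathfrak p_+\otimes\mathfrak g\cong\bigwedge^2(\mathfrak g/\mathfrak p)^*\otimes\mathfrak g$ generated by $\phi_0=e_{10}\wedge e_{31}\otimes f_{01}$. *)

(* Defs.v *)
From HB Require Import structures.
From mathcomp Require Import all_boot all_order all_algebra.
From mathcomp Require Import complex ring.
From mathcomp Require Import all_classical all_reals all_analysis.

Set Implicit Arguments.
Unset Strict Implicit.
Unset Printing Implicit Defensive.

Import Order.TTheory GRing.Theory Num.Theory.
Import numFieldNormedType.Exports.
Local Open Scope classical_set_scope.
Local Open Scope ring_scope.

(* The ground field K is meant to be R (split real form, smooth geometry) or
   R[i] (complex Lie algebra, holomorphic geometry): derivatives are taken over
   K, so that [smooth_on] below is C^oo for K = R and holomorphic for
   K = R[i]. *)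

Section Smooth.
Variable K : numFieldType.

Fixpoint Ck (k : nat) (V W : normedModType K) (U : set V) (f : V -> W) : Prop :=
  (forall x, U x -> {for x, continuous f}) /\
  if k is k'.+1 then
    forall v : V, (forall x, U x -> derivable f x v) /\ Ck k' U ('D_v f)
  else True.

(* On a set that is not open (e.g. a closed subgroup of GL_n), smooth means:
   locally the restriction of a smooth map of the ambient space. *)
Definition smooth_on (V W : normedModType K) (S : set V) (f : V -> W) : Prop :=
  forall x, S x -> exists (U : set V) (g : V -> W),
    [/\ open U, U x, forall k, Ck k U g & forall y, U y -> S y -> f y = g y].

(* The values of cmap outside cdom, and of cinv outside cmap @` cdom, are
   irrelevant. *)
Record chart (M : topologicalType) (n : nat) := Chart {
  cdom : set M;
  cmap : M -> 'cV[K]_n;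
  cinv : 'cV[K]_n -> M;
  cdom_open : open cdom;
  cran_open : open (cmap @` cdom);
  cmapK : forall u, cdom u -> cinv (cmap u) = u;
  cmap_continuous : {within cdom, continuous cmap};
  cinv_continuous : {within cmap @` cdom, continuous cinv} }.

Record manifold (n : nat) := Manifold {
  point_of :> topologicalType;
  mfd_hausdorff : hausdorff_space point_of;
  mfd_second_countable : @second_countable point_of;
  atlas : set (chart point_of n);
  chart_at : point_of -> chart point_of n;
  chart_at_atlas : forall u, atlas (chart_at u);
  chart_at_dom : forall u, cdom (chart_at u) u;
  atlas_compat : forall c c', atlas c -> atlas c' ->
    smooth_on (cmap c @` (cdom c `&` cdom c')) (cmap c' \o cinv c) }.

Definition mfd_smooth_on (n m : nat) (M : manifold n) (N : manifold m)
    (A : set M) (f : M -> N) : Prop :=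
  {within A, continuous f} /\
  forall c c', atlas c -> atlas c' ->
    smooth_on (cmap c @` (A `&` cdom c `&` f @^-1` cdom c'))
              (cmap c' \o f \o cinv c).

Definition mfd_smooth_fun_on (n : nat) (M : manifold n) (W : normedModType K)
    (A : set M) (f : M -> W) : Prop :=
  forall c, atlas c -> smooth_on (cmap c @` (A `&` cdom c)) (f \o cinv c).

(* Principal bundles whose structure group is a matrix group P.  Local
   triviality is given by a smooth local section s and the smooth P-component
   psi of the resulting trivialization: u |-> (bundle_proj u, psi u) is inverse to
   (y, p) |-> s y . p, from U x P to the preimage of U. *)
Record principal_bundle (n m d : nat) (P : set 'M[K]_d.+1) := PrincipalBundle {
  total_space : manifold n;
  base_space : manifold m;
  bundle_proj : total_space -> base_space;
  raction : total_space -> 'M[K]_d.+1 -> total_space;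
  proj_smooth : mfd_smooth_on setT bundle_proj;
  raction1 : forall u, raction u 1 = u;
  ractionM : forall u p q, P p -> P q ->
    raction (raction u p) q = raction u (p * q);
  proj_raction : forall u p, P p -> bundle_proj (raction u p) = bundle_proj u;
  raction_continuous :
    {within [set up : total_space * 'M[K]_d.+1 | P up.2],
       continuous (fun up => raction up.1 up.2)};
  raction_smooth : forall c c', atlas c -> atlas c' ->
    smooth_on
      [set xp : 'cV[K]_n * 'M[K]_d.+1 |
        [/\ (cmap c @` cdom c) xp.1, P xp.2
          & cdom c' (raction (cinv c xp.1) xp.2)]]
      (fun xp => cmap c' (raction (cinv c xp.1) xp.2));
  locally_trivial : forall y0 : base_space,
    exists (U : set base_space) (s : base_space -> total_space)
           (psi : total_space -> 'M[K]_d.+1),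
      [/\ open U /\ U y0,
          mfd_smooth_on U s /\ mfd_smooth_fun_on (bundle_proj @^-1` U) psi,
          forall y, U y -> bundle_proj (s y) = y,
          forall u, U (bundle_proj u) ->
            P (psi u) /\ raction (s (bundle_proj u)) (psi u) = u
        & forall y p, U y -> P p -> psi (raction (s y) p) = p] }.

Definition expmx (d : nat) (X : 'M[K]_d.+1) : 'M[K]_d.+1 :=
  limn (series (fun n => (n`!%:R)^-1 *: X ^+ n)).

End Smooth.

Section G2.
Variables (K : numFieldType) (r2 : K). (* r2 is the square root of 2 *)

(* An element of g is the column of its 14 parameters, in the order
   z1 z2 a10 a01 a11 a21 a31 a32 b10 b01 b11 b21 b31 b32. *)
Local Notation g := 'cV[K]_14.

Definition g2mx (x : g) : 'M[K]_7 :=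
  let z1 := x (inord 0) 0 in let z2 := x (inord 1) 0 in
  let a10 := x (inord 2) 0 in let a01 := x (inord 3) 0 in
  let a11 := x (inord 4) 0 in let a21 := x (inord 5) 0 in
  let a31 := x (inord 6) 0 in let a32 := x (inord 7) 0 in
  let b10 := x (inord 8) 0 in let b01 := x (inord 9) 0 in
  let b11 := x (inord 10) 0 in let b21 := x (inord 11) 0 in
  let b31 := x (inord 12) 0 in let b32 := x (inord 13) 0 in
  \matrix_(i, j) nth 0 (nth [::]
   [:: [:: 2 * z1 + z2; b10; b11; r2 * b21; b31; b32; 0];
       [:: a10; z1 + z2; b01; r2 * b11; - b21; 0; - b32];
       [:: a11; a01; z1; - r2 * b10; 0; b21; - b31];
       [:: r2 * a21; r2 * a11; - r2 * a10; 0; r2 * b10; - r2 * b11; - r2 * b21];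
       [:: a31; - a21; 0; r2 * a10; - z1; - b01; - b11];
       [:: a32; 0; a21; - r2 * a11; - a01; - z1 - z2; - b10];
       [:: 0; - a32; - a31; - r2 * a21; - a11; - a10; - 2 * z1 - z2]] i) j.

Definition g2coord (A : 'M[K]_7) : g :=
  \col_i nth 0
   [:: A (inord 2) (inord 2); A (inord 1) (inord 1) - A (inord 2) (inord 2);
       A (inord 1) (inord 0); A (inord 2) (inord 1); A (inord 2) (inord 0);
       A (inord 5) (inord 2); A (inord 4) (inord 0); A (inord 5) (inord 0);
       A (inord 0) (inord 1); A (inord 1) (inord 2); A (inord 0) (inord 2);
       A (inord 2) (inord 5); A (inord 0) (inord 4); A (inord 0) (inord 5)] i.

Definition bracket (x y : g) : g :=
  g2coord (g2mx x *m g2mx y - g2mx y *m g2mx x).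

Lemma g2mxK : cancel g2mx g2coord.
Proof.
move=> x; apply/colP => i; rewrite !mxE !inordK //.
rewrite -[i in RHS]inord_val.
case: i => [] [|[|[|[|[|[|[|[|[|[|[|[|[|[|i]]]]]]]]]]]]]] //= _.
by rewrite addrC addKr.
Qed.

Lemma g2mx_bracket x y : r2 ^+ 2 = 2 ->
  g2mx (bracket x y) = g2mx x *m g2mx y - g2mx y *m g2mx x.
Proof.
move=> h; rewrite /bracket.
pose rows z1 z2 a10 a01 a11 a21 a31 a32 b10 b01 b11 b21 b31 b32 : seq (seq K) :=
   [:: [:: 2 * z1 + z2; b10; b11; r2 * b21; b31; b32; 0];
       [:: a10; z1 + z2; b01; r2 * b11; - b21; 0; - b32];
       [:: a11; a01; z1; - r2 * b10; 0; b21; - b31];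
       [:: r2 * a21; r2 * a11; - r2 * a10; 0; r2 * b10; - r2 * b11; - r2 * b21];
       [:: a31; - a21; 0; r2 * a10; - z1; - b01; - b11];
       [:: a32; 0; a21; - r2 * a11; - a01; - z1 - z2; - b10];
       [:: 0; - a32; - a31; - r2 * a21; - a11; - a10; - 2 * z1 - z2]].
pose rows_of (z : g) := rows (z (inord 0) 0) (z (inord 1) 0) (z (inord 2) 0)
  (z (inord 3) 0) (z (inord 4) 0) (z (inord 5) 0) (z (inord 6) 0)
  (z (inord 7) 0) (z (inord 8) 0) (z (inord 9) 0) (z (inord 10) 0)
  (z (inord 11) 0) (z (inord 12) 0) (z (inord 13) 0).
have mxE7 z i j : (i < 7)%N -> (j < 7)%N ->
    g2mx z (inord i) (inord j) = nth 0 (nth [::] (rows_of z) i) j.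
  by move=> lei lej; rewrite mxE !inordK.
set M := _ - _.
have ME i j : (i < 7)%N -> (j < 7)%N -> M (inord i) (inord j) =
    foldr +%R 0 [seq nth 0 (nth [::] (rows_of x) i) k *
                     nth 0 (nth [::] (rows_of y) k) j -
                     nth 0 (nth [::] (rows_of y) i) k *
                     nth 0 (nth [::] (rows_of x) k) j | k <- iota 0 7].
  move=> lei lej; rewrite !mxE -sumrB foldrE big_map.
  rewrite -[iota 0 7]/(index_iota 0 7) big_mkord.
  by apply: eq_bigr => k _; rewrite -(mxE7 x) // -(mxE7 y) // -(mxE7 y) // -(mxE7 x) // !inord_val.
have coordE k : (k < 14)%N -> g2coord M (inord k) 0 = nth 0
   [:: M (inord 2) (inord 2); M (inord 1) (inord 1) - M (inord 2) (inord 2);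
       M (inord 1) (inord 0); M (inord 2) (inord 1); M (inord 2) (inord 0);
       M (inord 5) (inord 2); M (inord 4) (inord 0); M (inord 5) (inord 0);
       M (inord 0) (inord 1); M (inord 1) (inord 2); M (inord 0) (inord 2);
       M (inord 2) (inord 5); M (inord 0) (inord 4); M (inord 0) (inord 5)] k.
  by move=> lek; rewrite mxE inordK.
have {}mxE7 i j := mxE7 (g2coord M) i j.
move: ME; rewrite {1 2 3 4}/rows_of.
move: (x (inord 0) 0) (x (inord 1) 0) (x (inord 2) 0) (x (inord 3) 0)
      (x (inord 4) 0) (x (inord 5) 0) (x (inord 6) 0) (x (inord 7) 0)
      (x (inord 8) 0) (x (inord 9) 0) (x (inord 10) 0) (x (inord 11) 0)
      (x (inord 12) 0) (x (inord 13) 0)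
      (y (inord 0) 0) (y (inord 1) 0) (y (inord 2) 0) (y (inord 3) 0)
      (y (inord 4) 0) (y (inord 5) 0) (y (inord 6) 0) (y (inord 7) 0)
      (y (inord 8) 0) (y (inord 9) 0) (y (inord 10) 0) (y (inord 11) 0)
      (y (inord 12) 0) (y (inord 13) 0).
move: M mxE7 coordE => M mxE7 coordE.
move=> x0 x1 x2 x3 x4 x5 x6 x7 x8 x9 x10 x11 x12 x13.
move=> y0 y1 y2 y3 y4 y5 y6 y7 y8 y9 y10 y11 y12 y13 ME.
apply/matrixP => i j; rewrite -(inord_val i) -(inord_val j).
rewrite mxE7 // {mxE7}/rows_of !coordE // {coordE} [in LHS]/=.
case: i => [] [|[|[|[|[|[|[|i]]]]]]] //= _;
  case: j => [] [|[|[|[|[|[|[|j]]]]]]] //= _.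
all: by rewrite !ME //=; ring: h.
Qed.

(* Column vectors are acted upon from the left: ad x *m y = [x, y]. *)
Definition ad (x : g) : 'M[K]_14 :=
  \matrix_(i, j) bracket x (delta_mx j 0) i 0.

Definition killing (x y : g) : K := \tr (ad x *m ad y).

Definition Z1 : g := delta_mx (inord 0) 0.
Definition f01 : g := delta_mx (inord 3) 0.
Definition e10 : g := delta_mx (inord 8) 0.
Definition e31 : g := delta_mx (inord 12) 0.

Definition grade (k : int) : set g := [set x | bracket Z1 x = k%:~R *: x].

(* g^i; the index j < 7 stands for the degree j - 3. *)
Definition filtration (i : int) : set g :=
  [set x | exists y : 'I_7 -> g,
    (forall j : 'I_7, grade (j%:Z - 3) (y j)) /\
    x = \sum_(j < 7 | i <= j%:Z - 3) y j].

Definition parabolic : set g := filtration 0.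
Definition p_plus : set g := filtration 1.

(* The connected subgroup of Aut(g) with Lie algebra p = g^0, i.e. the group
   generated by exp(ad X), X in p (inverses are given by exp(ad (- X))). *)
Inductive P1 : set 'M[K]_14 :=
| P1_one : P1 1
| P1_exp X : parabolic X -> P1 (expmx (ad X))
| P1_mul A B : P1 A -> P1 B -> P1 (A * B).

(* Elements of /\^2 (g/p)^* (x) g and (g/p)^* (x) g are represented by the
   corresponding maps on g; tensors with entries in p_+ are identified with
   such maps through the Killing form. *)
Definition cochain1 := g -> g.
Definition cochain2 := g -> g -> g.

Definition tens (X v : g) : cochain1 := fun x => killing X x *: v.

Definition wedge_tens (X Y v : g) : cochain2 := fun x y =>
  (killing X x * killing Y y - killing X y * killing Y x) *: v.

Definition codiff_tens (X Y v : g) : cochain1 :=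
  - tens Y (bracket X v) + tens X (bracket Y v) - tens (bracket X Y) v.

(* The graph of the linear map d^* on /\^2 p_+ (x) g: an element is written as
   a finite sum of decomposables X /\ Y (x) v, and d^* is extended linearly. *)
Definition codiff_graph (phi : cochain2) (psi : cochain1) : Prop :=
  exists s : seq (g * g * g),
    [/\ forall t, t \in s -> p_plus t.1.1 /\ p_plus t.1.2,
        phi = \sum_(t <- s) wedge_tens t.1.1 t.1.2 t.2
      & psi = \sum_(t <- s) codiff_tens t.1.1 t.1.2 t.2].

Definition ker_codiff : set cochain2 := [set phi | codiff_graph phi 0].

Definition lie_action (X : g) (phi : cochain2) : cochain2 := fun x y =>
  bracket X (phi x y) - phi (bracket X x) y - phi x (bracket X y).

(* ker(d^* )^1, the sum of the Z1-eigenspaces in ker d^* with positive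
   eigenvalue. *)
Definition ker_codiff1 : set cochain2 :=
  [set phi | exists (n : nat) (lam : 'I_n -> K) (psi : 'I_n -> cochain2),
    (forall i, [/\ 0 < lam i, ker_codiff (psi i)
                 & lie_action Z1 (psi i) = lam i *: psi i]) /\
    phi = \sum_i psi i].

Definition group_action (A : 'M[K]_14) (phi : cochain2) : cochain2 :=
  fun x y => A *m phi (invmx A *m x) (invmx A *m y).

Definition P_submodule (V : set cochain2) : Prop :=
  [/\ V 0,
      forall a phi psi, V phi -> V psi -> V (a *: phi + psi)
    & forall A phi, P1 A -> V phi -> V (group_action A phi)].

Definition phi0 : cochain2 := wedge_tens e10 e31 f01.

Definition curvature_module : set cochain2 := smallest P_submodule [set phi0].

(* Cartan geometries of type (G, P1).  A tangent vector of the total space at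
   u is given by its coordinates v in a chart c around u, and omega c u *m v is
   the value of the Cartan connection on it.  The dimensions 14 = dim g and
   5 = dim g/p are forced by omega_u being an isomorphism. *)
Record cartan_geometry := CartanGeometry {
  bundle :> principal_bundle 14 5 P1;
  omega : chart K (total_space bundle) 14 -> total_space bundle -> 'M[K]_14;
  omega_chart : forall c c', atlas c -> atlas c' ->
    forall u v, cdom c u -> cdom c' u ->
    omega c' u *m 'D_v (cmap c' \o cinv c) (cmap c u) = omega c u *m v;
  omega_smooth : forall c, atlas c ->
    smooth_on (cmap c @` cdom c) (omega c \o cinv c);
  omega_iso : forall c, atlas c -> forall u, cdom c u -> omega c u \in unitmx;
  omega_equivariant : forall c c', atlas c -> atlas c' ->
    forall u A v, P1 A -> cdom c u -> cdom c' (raction u A) ->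
    omega c' (raction u A) *m
        'D_v (fun x => cmap c' (raction (cinv c x) A)) (cmap c u) =
      invmx A *m (omega c u *m v);
  omega_fundamental : forall c, atlas c -> forall u X,
    cdom c u -> parabolic X ->
    omega c u *m
      'D_1 (fun t : K => cmap c (raction u (expmx (ad (t *: X))))) 0 = X }.

Section Curvature.
Variable C : cartan_geometry.

(* d omega on two tangent vectors with coordinates v, w in the chart c, extended
   as constant (hence commuting) coordinate fields. *)
Definition d_omega (c : chart K (total_space C) 14) (u : total_space C) (v w : g) : g :=
  'D_v (fun x => omega c (cinv c x) *m w) (cmap c u) -
  'D_w (fun x => omega c (cinv c x) *m v) (cmap c u).

(* (1/2) [omega, omega] (v, w) = [omega v, omega w]. *)
Definition curvature (c : chart K (total_space C) 14) (u : total_space C) (v w : g) : g :=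
  d_omega c u v w + bracket (omega c u *m v) (omega c u *m w).

Definition kappa (u : total_space C) : cochain2 := fun x y =>
  let c := chart_at u in
  curvature c u (invmx (omega c u) *m x) (invmx (omega c u) *m y).

Definition regular_normal : Prop := forall u, ker_codiff1 (kappa u).

End Curvature.
End G2.

(* Main.v *)
Require Import Defs.
From Stdlib Require Import ZArith.
From HB Require Import structures.
From mathcomp Require Import all_boot all_order all_algebra.
From mathcomp Require Import complex.
From mathcomp Require Import all_classical all_reals all_analysis.
From mathcomp Require Import ssrZ zify ring.

Set Implicit Arguments.
Unset Strict Implicit.
Unset Printing Implicit Defensive.

Import Order.TTheory GRing.Theory Num.Theory.
Import numFieldNormedType.Exports.
Local Open Scope ring_scope.

(** Write kappa in the basis of g: its components are kappa(f_i, f_j)_k, where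
    f_i, f_j run over the five basis vectors of g_-, because kappa is
    horizontal.  A component has a degree, the eigenvalue of Z1 on it, and
    regularity kills the components of degree less than 1; the largest degree
    is 9.

    The curvature module E is spanned by 24 explicit cochains [Ebasis], found
    by applying the raising operators e10 and e01 to phi0.  They do lie in E
    ([Ebasis_in_module]): a nilpotent [ad X] acts on cochains through
    exp(t ad X), polynomially in t, so a P-submodule contains the linear
    coefficient in t, which is the Lie derivative ([P_submodule_lie]).

    That kappa lies in their span is shown by induction on the degree l.
    Suppose that at every point of the bundle the part of kappa of degree less
    than l lies in the span.  The Bianchi identity
<<
      sum over cyclic (a, b, c) of
        [a, kappa(b, c)] - kappa([a, b], c) + kappa(kappa(a, b), c)
          + (d kappa)(a; b, c) = 0
>>
    in degree l contains the components of degree l linearly through its first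
    two terms.  Differentiation along a in g_- lowers the degree, so the
    derivatives are those of components of degree less than l; differentiating
    the linear equations that these satisfy on the whole bundle shows that the
    derivatives satisfy them too.  The quadratic term would need a component of
    degree less than l with values in g_-, and no element of the span has one
    ([quadratic_vanish]).  What remains is, together with the equation
    codiff kappa = 0 in degree l, a system of linear equations with integer
    coefficients.  An exact elimination verifies for l = 1, ..., 9 that the
    equations of the span follow from it ([check_step], [in_E_step]).  After
    degree 9 kappa is a combination of [Ebasis] with the pivot components as
    coefficients ([E_combination]); parts (a) and (b) are read off from the
    list.

    The Bianchi identity itself is obtained by differentiating the structure
    equation in a chart ([bianchi_identity]).  Since the chart used to define
    kappa at a point may change from point to point, this first needs that the
    curvature does not depend on the chart ([kappa_inE]).  Both steps rest on
    the symmetry of second derivatives of maps with continuous second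
    derivatives, and on the chain rule for such maps; over the real and the
    complex numbers alike these are consequences of a mean value inequality on
    the segment from 0 to 1 ([mean_value_inequality]). *)

(** * Elimination for linear forms with integer coefficients *)

Section Elimination.
Variable T : eqType.

(** A sparse form, as a list of terms in no particular order; the indeterminate
    of its first term serves as the pivot. *)
Definition form := seq (Z * T).

Fixpoint add_term (c : Z) (x : T) (r : form) : form :=
  match r with
  | [::] => if c == 0 then [::] else [:: (c, x)]
  | (d, y) :: r' =>
    if x == y then let e := c + d in if e == 0 then r' else (e, y) :: r'
    else (d, y) :: add_term c x r'
  end.

Definition add_form (a : Z) (r s : form) : form :=
  foldr (fun t => add_term (a * t.1)%R t.2) s r.

Fixpoint coef (x : T) (r : form) : Z :=
  if r is (d, y) :: r' then if x == y then d else coef x r' else 0.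

(** Eliminates the pivot of [p] from [r] by cross-multiplication, dividing by
    the gcd to keep the coefficients integral and small.  The test [c' == 0]
    guarantees that [r] is multiplied by a nonzero integer whatever the
    input. *)
Definition reduce (r p : form) : form :=
  if p is (c, x) :: _ then
    let d := coef x r in
    let e := Z.gcd c d in
    let c' := Z.div c e in
    if (d == 0) || (c' == 0) then r
    else add_form c' r (add_form (- Z.div d e)%R p [::])
  else r.

(** Adding [r] to the empty form merges its repeated indeterminates. *)
Definition echelon_step (B : seq form) (r : form) : seq form :=
  let r' := foldl reduce (add_form 1%R r [::]) B in if nilp r' then B else rcons B r'.

Definition echelon (rows : seq form) : seq form := foldl echelon_step [::] rows.

Definition in_span (rows targets : seq form) : bool :=
  let B := echelon rows in
  all (fun r => nilp (foldl reduce (add_form 1%R r [::]) B)) targets.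

End Elimination.

Section Evaluation.
Variable K : numFieldType.

Definition zK (z : Z) : K := (int_of_Z z)%:~R.

Lemma zKD a b : zK (a + b)%R = zK a + zK b.
Proof. by rewrite /zK !rmorphD. Qed.

Lemma zKM a b : zK (a * b)%R = zK a * zK b.
Proof. by rewrite /zK !rmorphM. Qed.

Lemma zKN a : zK (- a)%R = - zK a.
Proof. by rewrite /zK !rmorphN. Qed.

Lemma zK0 : zK 0%R = 0. Proof. by []. Qed.
Lemma zK1 : zK 1%R = 1. Proof. by []. Qed.

Lemma zK_eq0 a : (zK a == 0) = (a == 0).
Proof. by rewrite /zK intr_eq0; apply/eqP/eqP; lia. Qed.

Variables (T : eqType) (V : lmodType K) (v : T -> V).

(** The value of a form when the indeterminate [x] stands for the vector [v x].
    With scalars as values, forms are linear equations; with cochains as values,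
    they are elements of a space of cochains. *)
Definition ev (r : form T) : V := \sum_(t <- r) zK t.1 *: v t.2.

Lemma ev_nil : ev [::] = 0. Proof. by rewrite /ev big_nil. Qed.

Lemma ev_cons c x r : ev ((c, x) :: r) = zK c *: v x + ev r.
Proof. by rewrite /ev big_cons. Qed.

Lemma ev_cat r s : ev (r ++ s) = ev r + ev s.
Proof. by rewrite /ev big_cat. Qed.

Lemma ev_add_term c x r : ev (add_term c x r) = zK c *: v x + ev r.
Proof.
elim: r => [|[d y] r IHr] /=.
  by case: eqP => [->|_]; rewrite ?ev_cons ev_nil // zK0 scale0r addr0.
case: eqP => [<-|_]; last by rewrite !ev_cons IHr addrCA.
case: eqP => [cd0|_].
  by rewrite ev_cons addrA -scalerDl -zKD cd0 zK0 scale0r add0r.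
by rewrite !ev_cons zKD scalerDl addrA.
Qed.

Lemma ev_add_form a r s : ev (add_form a r s) = zK a *: ev r + ev s.
Proof.
elim: r => [|[d y] r IHr] /=; first by rewrite ev_nil scaler0 add0r.
by rewrite ev_add_term IHr ev_cons scalerDr scalerA zKM addrA.
Qed.

Variable S : V -> Prop.
Hypothesis S0 : S 0.
Hypothesis SD : forall a x y, S x -> S y -> S (a *: x + y).

Lemma subspaceZ a x : S x -> S (a *: x).
Proof. by move=> Sx; rewrite -[_ *: _]addr0; apply: SD. Qed.

Lemma subspaceD x y : S x -> S y -> S (x + y).
Proof. by move=> Sx Sy; rewrite -[x]scale1r; apply: SD. Qed.

Lemma subspace_sum I (s : seq I) (P : pred I) F :
  (forall i, P i -> S (F i)) -> S (\sum_(i <- s | P i) F i).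
Proof. by move=> SF; apply: big_ind => //; apply: subspaceD. Qed.

(** The reduced form is a nonzero multiple of [r] plus a multiple of [p]. *)
Lemma reduce_sound r p : S (ev p) -> S (ev (reduce r p)) <-> S (ev r).
Proof.
case: p => [|[c x] p] // Sp; rewrite /reduce.
case: ifP => //; set c' := Z.div _ _; move=> /norP[_ c'0].
rewrite !ev_add_form ev_nil addr0; set d' := - Z.div _ _.
have Sp' a : S (zK a *: ev ((c, x) :: p)) by apply: subspaceZ.
split=> [Sr|Sr]; last by apply: subspaceD => //; apply: subspaceZ.
rewrite -zK_eq0 in c'0.
rewrite -[ev r](scalerK c'0); apply: subspaceZ.
rewrite -[_ *: _](addrK (zK d' *: ev ((c, x) :: p))); apply: subspaceD => //.
by rewrite -scaleN1r; apply: subspaceZ.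
Qed.

Lemma reduces_sound B r : (forall p, p \in B -> S (ev p)) ->
  S (ev (foldl (@reduce T) r B)) <-> S (ev r).
Proof.
elim: B r => //= p B IHB r SB; rewrite IHB; last first.
  by move=> q qB; apply: SB; rewrite in_cons qB orbT.
by apply: reduce_sound; apply: SB; rewrite mem_head.
Qed.

Lemma echelon_sound rows : (forall p, p \in rows -> S (ev p)) ->
  forall p, p \in echelon rows -> S (ev p).
Proof.
rewrite /echelon => Srows.
suff: forall B, (forall p, p \in B -> S (ev p)) ->
  forall p, p \in foldl (@echelon_step T) B rows -> S (ev p) by apply.
elim: rows Srows => //= r rows IH Srows B SB; apply: IH => [p prows|p].
  by apply: Srows; rewrite in_cons prows orbT.
rewrite /echelon_step; case: ifP => _; first exact: SB.
rewrite mem_rcons in_cons => /predU1P[->|]; last exact: SB.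
apply/reduces_sound => //; rewrite ev_add_form ev_nil addr0 zK1 scale1r.
by apply: Srows; rewrite mem_head.
Qed.

(** Elimination changes the value of a form only by a nonzero factor and by
    values of forms already known to lie in the subspace [S].  Hence a target
    that reduces to zero has its value in [S]. *)
Theorem in_span_sound rows targets : in_span rows targets ->
  (forall p, p \in rows -> S (ev p)) -> forall r, r \in targets -> S (ev r).
Proof.
move=> /allP spanr Srows r /spanr/nilP r0.
have := reduces_sound (add_form 1%R r [::]) (echelon_sound Srows).
by rewrite r0 ev_nil ev_add_form ev_nil addr0 zK1 scale1r => -[+ _]; apply.
Qed.

End Evaluation.

(** * The structure constants and the linear systems *)

Local Open Scope Z_scope.
Definition entry (i j k : nat) (c : Z) := (i, j, k, c).
(** The structure constants of the basis Z1, Z2, f10, f01, f11, f21, f31, f32,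
    e10, e01, e11, e21, e31, e32, whose members are numbered from 0 to 13.  In
    [entry i j k c] the integer c is the coefficient of the k-th basis vector in
    the bracket of the i-th and the j-th; only one order of each pair is
    listed. *)
Definition brtab : seq (nat * nat * nat * Z) := [::
  entry 2 0 2 1; entry 3 1 3 1; entry 3 2 4 1; entry 4 0 4 1; entry 4 1 4 1;
  entry 4 2 5 2; entry 5 0 5 2; entry 5 1 5 1; entry 5 2 6 (-3); entry 5 4 7 3;
  entry 6 0 6 3; entry 6 1 6 1; entry 6 3 7 1; entry 7 0 7 3; entry 7 1 7 2;
  entry 8 0 8 (-1); entry 8 2 0 2; entry 8 2 1 (-3); entry 8 4 3 (-3); entry 8 5 4 (-2);
  entry 8 6 5 1; entry 9 1 9 (-1); entry 9 3 0 (-1); entry 9 3 1 2; entry 9 4 2 1;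
  entry 9 7 6 (-1); entry 9 8 10 (-1); entry 10 0 10 (-1); entry 10 1 10 (-1); entry 10 2 9 (-3);
  entry 10 3 8 1; entry 10 4 0 (-1); entry 10 4 1 3; entry 10 5 2 2; entry 10 7 5 (-1);
  entry 10 8 11 (-2); entry 11 0 11 (-2); entry 11 1 11 (-1); entry 11 2 10 (-2); entry 11 4 8 2;
  entry 11 5 0 1; entry 11 6 2 (-1); entry 11 7 4 1; entry 11 8 12 3; entry 11 10 13 (-3);
  entry 12 0 12 (-3); entry 12 1 12 (-1); entry 12 2 11 1; entry 12 5 8 (-1); entry 12 6 0 1;
  entry 12 6 1 (-1); entry 12 7 3 1; entry 12 9 13 (-1); entry 13 0 13 (-3); entry 13 1 13 (-2);
  entry 13 3 12 (-1); entry 13 4 11 (-1); entry 13 5 10 1; entry 13 6 9 1; entry 13 7 1 1].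
Definition mono (c : Z) (i j k : nat) : Z * seq nat := (c, [:: i; j; k]).
(** A basis of the curvature module.  The indeterminate [:: i; j; k] is the
    component with index k of the value on the i-th and j-th basis vectors,
    i < j.  The first line is phi0 up to a factor, the others come from it by
    repeated application of e10 and e01 followed by reduction: the first
    indeterminate of each line has coefficient 1 and occurs in no other line. *)
Definition Ebasis : seq (form (seq nat)) := [::
  [:: mono 1 2 6 3];
  [:: mono 1 2 6 0; mono (-2) 2 6 1; mono (-1) 2 7 3; mono 1 4 6 3];
  [:: mono 1 2 6 8; mono (-2) 5 6 3];
  [:: mono 1 2 6 9; mono 1 2 7 0; mono (-2) 2 7 1; mono (-1) 4 6 0; mono 2 4 6 1; mono 1 4 7 3];
  [:: mono 1 2 6 10; mono (-1) 2 7 8; mono 1 4 6 8; mono (-2) 5 6 0; mono 4 5 6 1; mono 2 5 7 3];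
  [:: mono 1 2 7 9; mono (-1) 4 6 9; mono (-1) 4 7 0; mono 2 4 7 1];
  [:: mono 1 2 6 11; mono 2 5 6 8; mono (-1) 6 7 3];
  [:: mono 1 2 7 10; mono (-1) 4 6 10; mono 1 4 7 8; mono (-2) 5 6 9; mono (-2) 5 7 0; mono 4 5 7 1];
  [:: mono 1 4 7 9];
  [:: mono 1 2 6 12];
  [:: mono 1 2 7 11; mono (-1) 4 6 11; mono (-2) 5 6 10; mono 2 5 7 8; mono 1 6 7 0; mono (-2) 6 7 1];
  [:: mono 1 4 7 10; mono 2 5 7 9];
  [:: mono 1 2 6 13; mono (-2) 5 6 11; mono (-1) 6 7 8];
  [:: mono 1 2 7 12; mono (-1) 4 6 12; mono 2 5 6 11; mono 1 6 7 8];
  [:: mono 1 4 7 11; mono 2 5 7 10; mono (-1) 6 7 9];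
  [:: mono 1 5 6 12];
  [:: mono 1 2 7 13; mono (-1) 4 6 13; mono (-2) 5 7 11; mono 1 6 7 10];
  [:: mono 1 4 7 12; mono (-2) 5 7 11; mono 1 6 7 10];
  [:: mono 1 4 7 13];
  [:: mono 1 6 7 11; mono (-2) 5 6 13];
  [:: mono 1 5 7 12; mono 1 5 6 13];
  [:: mono 1 6 7 12];
  [:: mono 1 5 7 13];
  [:: mono 1 6 7 13]].

Definition sc_of (tab : seq (nat * nat * nat * Z)) (i j k : nat) : Z :=
  foldr (fun t acc => let: (i', j', k', c) := t in
     if k' != k then acc
     else if (i == i') && (j == j') then c + acc
     else if (i == j') && (j == i') then - c + acc else acc) 0 tab.

Definition sc := sc_of brtab.

(** The eigenvalue of Z1 on each basis vector. *)
Definition dg (k : nat) : Z :=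
  nth 0 [:: 0; 0; -1; 0; -1; -2; -3; -3; 1; 0; 1; 2; 3; 3] k.

(** The eigenvalue of Z1 on a cochain whose only component is [:: i; j; k]. *)
Definition vdeg (i j k : nat) : Z := dg k - dg i - dg j.

(** The basis vectors of g_-, which form a basis of g modulo p. *)
Definition neg : seq nat := [:: 2; 4; 5; 6; 7]%N.

(** For each triple (i, j, w), the element of p_+ dual to the i-th basis vector
    for the Killing form is w / 24 times the j-th one. *)
Definition dual_neg : seq (nat * nat * Z) :=
  [:: (2%N, 8%N, 1); (4%N, 10%N, 1); (5%N, 11%N, 1); (6%N, 12%N, 3); (7%N, 13%N, 3)].

Notation lform := (form (seq nat)).

Definition scale (c : Z) (r : lform) : lform := [seq (c * t.1, t.2) | t <- r].
(** An indeterminate [:: a; i; j; k] with four letters stands for the derivative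
    of the component [:: i; j; k] in the direction of the a-th basis vector. *)
Definition prefix_form (p : seq nat) (r : lform) : lform :=
  [seq (t.1, p ++ t.2) | t <- r].

Definition alt (i j k : nat) : lform :=
  if (i < j)%N then [:: (1%R, [:: i; j; k])]
  else if (j < i)%N then [:: (-1%R, [:: j; i; k])] else [::].

(** The component of a horizontal cochain of positive degree. *)
Definition component (i j k : nat) : lform :=
  if (i \in neg) && (j \in neg) && (0 <? vdeg i j k) then alt i j k else [::].

(** In the span of [Ebasis] the component [v] equals this combination of pivot
    components. *)
Definition expand (v : seq nat) : lform :=
  [seq (coef v b, (head (0, [::]) b).2) | b <- Ebasis & coef v b != 0].

Definition lsum (s : seq nat) (F : nat -> lform) : lform := flatten [seq F i | i <- s].

(** The coordinate m of the codifferential on the j-th basis vector, times 48 to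
    clear the denominators. *)
Definition codiff_row (j m : nat) : lform :=
  flatten [seq let: (i, i', w) := t in
    lsum (iota 0 14) (fun k => scale (2 * w * sc i' k m)%R (component j i k)) ++
    lsum (iota 0 14) (fun d => scale (w * sc i' j d)%R (component i d m))
  | t <- dual_neg].

(** One cyclic term of the Bianchi identity.  The derivative is expressed by
    derivatives of pivot components: it has lower degree, where the curvature is
    known to lie in the span of [Ebasis].  For the same reason the quadratic
    term is omitted: it vanishes. *)
Definition bianchi_part (a b c m : nat) : lform :=
  lsum (iota 0 14) (fun k => scale (sc a k m) (component b c k)) ++
  lsum (iota 0 14) (fun d => scale (- sc a b d)%R (component d c m)) ++
  prefix_form [:: a] (flatten [seq scale t.1 (expand t.2) | t <- component b c m]).

Definition bianchi_row (a b c m : nat) : lform :=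
  bianchi_part a b c m ++ bianchi_part b c a m ++ bianchi_part c a b m.

Definition neg_pairs : seq (nat * nat) := [seq ij <- [seq (i, j) | i <- neg, j <- neg] | (ij.1 < ij.2)%N].

Definition vars : seq (nat * nat * nat) := [seq (ij, k) | ij <- neg_pairs, k <- iota 0 14].

(** The equation of the span of [Ebasis] for the component [:: i; j; k]. *)
Definition target (i j k : nat) : lform :=
  (1%R, [:: i; j; k]) :: scale (-1)%R (expand [:: i; j; k]).

Definition targets (l : Z) : seq lform :=
  [seq target v.1.1 v.1.2 v.2 | v <- vars & vdeg v.1.1 v.1.2 v.2 == l].

Definition codiff_rows (l : Z) : seq lform :=
  [seq codiff_row jm.1 jm.2 | jm <- [seq (j, m) | j <- neg, m <- iota 0 14] &
     dg jm.2 - dg jm.1 == l].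

Definition bianchi_rows (l : Z) : seq lform :=
  [seq bianchi_row v.1.1.1 v.1.1.2 v.1.2 v.2 |
     v <- [seq (abc, m) | abc <- [seq (ab, c) | ab <- neg_pairs, c <- neg], m <- iota 0 14] &
     (v.1.1.2 < v.1.2)%N && (dg v.2 - dg v.1.1.1 - dg v.1.1.2 - dg v.1.2 == l)].

(** The system in degree [l] is closed: the codifferential preserves the degree,
    and the row of the Bianchi identity on a, b, c with coordinate m involves
    undifferentiated components of the single degree
    dg m - dg a - dg b - dg c. *)
Definition check_step (l : Z) : bool :=
  in_span (codiff_rows l ++ bianchi_rows l) (targets l).

(** The action of the a-th basis vector on the elementary cochain
    [:: i; j; k]. *)
Definition act_mono (a i j k : nat) : lform :=
  lsum (iota 0 14) (fun l => scale (sc a k l) (alt i j l)) ++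
  lsum (iota 0 14) (fun d => scale (- sc a d i)%R (alt d j k)) ++
  lsum (iota 0 14) (fun d => scale (- sc a d j)%R (alt i d k)).

Definition act_form (a : nat) (r : lform) : lform :=
  flatten [seq scale t.1 (if t.2 is [:: i; j; k] then act_mono a i j k else [::]) | t <- r].

(** Every line of [Ebasis] after the first is a combination of the images of the
    preceding lines under e10 and e01. *)
Definition check_module : bool :=
  let acts := [seq [:: act_form 8 b; act_form 9 b] | b <- Ebasis] in
  all (fun n => in_span (flatten (take n acts)) [:: nth [::] Ebasis n]) (iota 1 23).

Local Close Scope Z_scope.

(** * The Lie algebra in coordinates *)

Section LieAlgebra.
Variables (K : numFieldType) (r2 : K).
Hypothesis r2_sqr : r2 ^+ 2 = 2.
Local Notation g := 'cV[K]_14.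
Local Notation "[ x , y ]" := (bracket r2 x y) (at level 0, x, y at level 200).

Lemma g2mx_is_linear : linear (g2mx r2).
Proof.
move=> a x y; apply/matrixP => i j; rewrite !mxE.
move: (x _ _) (x _ _) (x _ _) (x _ _) (x _ _) (x _ _) (x _ _) (x _ _) (x _ _)
  (x _ _) (x _ _) (x _ _) (x _ _) (x _ _) (y _ _) (y _ _) (y _ _) (y _ _)
  (y _ _) (y _ _) (y _ _) (y _ _) (y _ _) (y _ _) (y _ _) (y _ _) (y _ _) (y _ _).
move=> *.
case: i => [] [|[|[|[|[|[|[|i]]]]]]] //= _;
  case: j => [] [|[|[|[|[|[|[|j]]]]]]] //= _; ring.
Qed.
HB.instance Definition _ := GRing.isLinear.Build K g 'M[K]_7 _ (g2mx r2) g2mx_is_linear.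

Lemma g2coord_is_linear : linear (@g2coord K).
Proof.
move=> a x y; apply/colP => i; rewrite !mxE.
case: i => [] [|[|[|[|[|[|[|[|[|[|[|[|[|[|i]]]]]]]]]]]]]] //= _; ring.
Qed.
HB.instance Definition _ := GRing.isLinear.Build K 'M[K]_7 g _ (@g2coord K) g2coord_is_linear.

Lemma bracketC x y : [x, y] = - [y, x].
Proof. by rewrite /bracket -[RHS]linearN opprB. Qed.

Lemma bracketl_is_linear x : linear (bracket r2 x).
Proof.
move=> a y z; rewrite /bracket linearP mulmxDr mulmxDl -scalemxAr -scalemxAl.
by rewrite opprD addrACA -scalerBr linearP.
Qed.
HB.instance Definition _ x := GRing.isLinear.Build K g g _ (bracket r2 x) (bracketl_is_linear x).

Lemma bracketDl x y z : [x + y, z] = [x, z] + [y, z].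
Proof. by rewrite bracketC linearD opprD -!bracketC. Qed.

Lemma bracketZl a x z : [a *: x, z] = a *: [x, z].
Proof. by rewrite bracketC linearZ -scalerN -bracketC. Qed.

Lemma bracket_suml I (s : seq I) P F z :
  [\sum_(i <- s | P i) F i, z] = \sum_(i <- s | P i) [F i, z].
Proof.
rewrite bracketC linear_sum -sumrN; apply: eq_bigr => i _.
by rewrite -bracketC.
Qed.

(** The matrices of g are closed under commutators, so the identity is that of
    the associative algebra of 7 by 7 matrices. *)
Lemma jacobi x y z : [x, [y, z]] + [y, [z, x]] + [z, [x, y]] = 0.
Proof.
apply: (can_inj (@g2mxK K r2)); rewrite !raddfD /= raddf0 !g2mx_bracket //.
set X := g2mx r2 x; set Y := g2mx r2 y; set Z := g2mx r2 z.
rewrite !mulmxBr !mulmxBl !mulmxA.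
move: (X *m Y *m Z) (X *m Z *m Y) (Y *m X *m Z) (Y *m Z *m X) (Z *m X *m Y)
  (Z *m Y *m X) => *.
by apply/matrixP => i j; rewrite !mxE; ring.
Qed.

Definition co (x : g) (n : nat) : K := x (inord n) 0.

(** The bracket is computed entry by entry; the square root of 2 occurs only
    squared, so the structure constants are integers. *)
Lemma bracket_table x y k : (k < 14)%N ->
  co [x, y] k = \sum_(t <- brtab | t.1.2 == k)
    zK K t.2 * (co x t.1.1.1 * co y t.1.1.2 - co x t.1.1.2 * co y t.1.1.1).
Proof.
move=> k14; rewrite /co mxE inordK //.
pose m (z : g) i j := nth 0 (nth [::]
   [:: [:: 2 * co z 0 + co z 1; co z 8; co z 10; r2 * co z 11; co z 12; co z 13; 0];
       [:: co z 2; co z 0 + co z 1; co z 9; r2 * co z 10; - co z 11; 0; - co z 13];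
       [:: co z 4; co z 3; co z 0; - r2 * co z 8; 0; co z 11; - co z 12];
       [:: r2 * co z 5; r2 * co z 4; - r2 * co z 2; 0; r2 * co z 8; - r2 * co z 10; - r2 * co z 11];
       [:: co z 6; - co z 5; 0; r2 * co z 2; - co z 0; - co z 9; - co z 10];
       [:: co z 7; 0; co z 5; - r2 * co z 4; - co z 3; - co z 0 - co z 1; - co z 8];
       [:: 0; - co z 7; - co z 6; - r2 * co z 5; - co z 4; - co z 2; - 2 * co z 0 - co z 1]] i) j.
have mE z i j : (i < 7)%N -> (j < 7)%N -> g2mx r2 z (inord i) (inord j) = m z i j.
  by move=> i7 j7; rewrite mxE !inordK.
have ME i j : (i < 7)%N -> (j < 7)%N ->
    (g2mx r2 x *m g2mx r2 y - g2mx r2 y *m g2mx r2 x) (inord i) (inord j) =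
    foldr +%R 0 [seq m x i k * m y k j - m y i k * m x k j | k <- iota 0 7].
  move=> i7 j7; rewrite !mxE -sumrB foldrE big_map.
  rewrite -[iota 0 7]/(index_iota 0 7) big_mkord.
  by apply: eq_bigr => l _; rewrite -!mE // !inord_val.
have zKneg p : zK K (Zneg p) = - zK K (Zpos p) by rewrite -zKN.
have zK1' : zK K (Zpos 1) = 1 by [].
have zK2 : zK K (Zpos 2) = 2 by [].
have zK3 : zK K (Zpos 3) = 3 by [].
set M := (_ - _) in ME *; clearbody M.
rewrite unlock /reducebig -!/(co _ _).
case: k k14 => [|[|[|[|[|[|[|[|[|[|[|[|[|[|k]]]]]]]]]]]]]] //.
all: move=> _; rewrite [LHS]/= !ME // /m; rewrite /= ?zKneg ?zK2 ?zK3 ?zK1' -!/(co _ _).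
all: ring: r2_sqr.
Qed.

End LieAlgebra.

Section Coordinates.
Variables (K : numFieldType) (r2 : K).
Hypothesis r2_sqr : r2 ^+ 2 = 2.
Local Notation g := 'cV[K]_14.
Local Notation "[ x , y ]" := (bracket r2 x y) (at level 0, x, y at level 200).

Definition bas (n : nat) : g := delta_mx (inord n) 0.

Lemma inord_inj14 i j : (i < 14)%N -> (j < 14)%N ->
  ((inord i : 'I_14) == inord j) = (i == j).
Proof. by move=> i14 j14; rewrite -val_eqE /= !inordK. Qed.

Lemma co_bas i j : (i < 14)%N -> (j < 14)%N -> co (bas i) j = (i == j)%:R.
Proof. by move=> i14 j14; rewrite /co mxE eqxx andbT inord_inj14 // eq_sym. Qed.

Lemma co_eq (x y : g) : (forall n, (n < 14)%N -> co x n = co y n) -> x = y.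
Proof.
move=> xy; apply/colP => i; have := xy i (ltn_ord i).
by rewrite /co inord_val.
Qed.

Lemma coD x y n : co (x + y : g) n = co x n + co y n. Proof. by rewrite /co mxE. Qed.
Lemma coB x y n : co (x - y : g) n = co x n - co y n. Proof. by rewrite /co !mxE. Qed.
Lemma coN x n : co (- x : g) n = - co x n. Proof. by rewrite /co mxE. Qed.
Lemma coZ a x n : co (a *: x : g) n = a * co x n. Proof. by rewrite /co mxE. Qed.
Lemma co0 n : co (0 : g) n = 0. Proof. by rewrite /co mxE. Qed.
Lemma co_sum I (s : seq I) P F n :
  co (\sum_(i <- s | P i) F i : g) n = \sum_(i <- s | P i) co (F i) n.
Proof. by rewrite /co summxE. Qed.

Lemma basE (x : g) : x = \sum_(n <- iota 0 14) co x n *: bas n.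
Proof.
rewrite {1}[x]matrix_sum_delta (eq_bigr (fun i => x i 0 *: delta_mx i 0)); last first.
  by move=> i _; rewrite big_ord1.
rewrite -[iota 0 14]/(index_iota 0 14) big_mkord; apply: eq_bigr => i _.
by rewrite /co /bas inord_val.
Qed.

Lemma co_bracket_bas i j k : (i < 14)%N -> (j < 14)%N -> (k < 14)%N ->
  co [bas i, bas j] k = zK K (sc i j k).
Proof.
move=> i14 j14 k14; rewrite (bracket_table r2_sqr) //.
have : all (fun t => [&& t.1.1.1 != t.1.1.2, t.1.1.1 < 14 & t.1.1.2 < 14]%N) brtab by [].
rewrite /sc; elim: brtab => [|[[[i' j'] k'] c] tab IH] /=; first by rewrite big_nil.
case/andP=> /and3P[ij i14' j14'] /IH {}IH.
rewrite big_cons [t in zK K t]/= /=; case: eqP => //= _; rewrite IH !co_bas //.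
move: (sc_of tab i j k) => S.
case: (i =P i') ij => [<-|_] ij; case: (j =P j') ij => [<-|_] ij /=;
  rewrite ?(mul1r, mul0r, mulr1, mulr0, subr0, sub0r).
- by rewrite (negPf ij) mul0r subr0 mulr1 -zKD.
all: by do 2!case: eqP => _ //=;
  rewrite ?(mulr0, mul0r, oppr0, add0r, mulr1) // mulrN1 -zKN -zKD.
Qed.

Lemma co_bracketl a y m : (a < 14)%N -> (m < 14)%N ->
  co [bas a, y] m = \sum_(k <- iota 0 14) zK K (sc a k m) * co y k.
Proof.
move=> a14 m14; rewrite {1}[y]basE linear_sum co_sum big_seq [RHS]big_seq.
apply: eq_bigr => k; rewrite mem_iota /= add0n => k14.
by rewrite linearZ coZ co_bracket_bas // mulrC.
Qed.

Definition idg (n : nat) : int := int_of_Z (dg n).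

Lemma co_bracketZ1 x n : (n < 14)%N -> co [Z1 K, x] n = (idg n)%:~R * co x n.
Proof.
move=> n14; rewrite -/(bas 0) co_bracketl //.
have : all (fun n => all (fun k => sc 0 k n == if k == n then dg n else 0) (iota 0 14))
   (iota 0 14) by vm_compute.
have nin : n \in iota 0 14 by rewrite mem_iota.
move=> /allP/(_ n nin)/allP sc0.
rewrite (bigD1_seq n) ?iota_uniq //= (eqP (sc0 n nin)) eqxx.
rewrite big_seq_cond big1 ?addr0 // => k /andP[kin /negPf kn].
by rewrite (eqP (sc0 k kin)) kn zK0 mul0r.
Qed.

Lemma grade_co k x n : grade r2 k x -> (n < 14)%N -> idg n != k -> co x n = 0.
Proof.
move=> xk n14 nk; apply: contraNeq nk => x0; apply/eqP.
have := co_bracketZ1 x n14; rewrite [[_, _]]xk coZ => /(mulIf x0)/eqP.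
by rewrite eqr_int => /eqP.
Qed.

(** Since Z1 is diagonal in the basis, a graded piece is spanned by the basis
    vectors of that degree; this and the next lemma turn membership in the
    filtration into the vanishing of coordinates. *)
Lemma filtration_co i x n : filtration r2 i x -> (n < 14)%N -> idg n < i -> co x n = 0.
Proof.
move=> [y [yj ->]] n14 ni; rewrite co_sum big1 // => j ij.
by apply: (grade_co (yj j)) => //; apply: contraTneq ni => ->; rewrite -leNgt.
Qed.

Lemma co_filtration i x :
  (forall n, (n < 14)%N -> idg n < i -> co x n = 0) -> filtration r2 i x.
Proof.
move=> x0; pose y (j : 'I_7) := \sum_(n <- iota 0 14 | idg n == j%:Z - 3) co x n *: bas n.
exists y; split=> [j|].
  rewrite /grade /=; apply: co_eq => n n14.
  rewrite co_bracketZ1 // coZ /y co_sum; have [nj|nj] := eqVneq (idg n) (j%:Z - 3).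
    by rewrite nj.
  rewrite big1_seq ?mulr0 // => m; rewrite mem_iota /= => /andP[/eqP mj m14].
  rewrite coZ co_bas //; case: eqP => [mn|]; last by rewrite mulr0.
  by rewrite -mn mj eqxx in nj.
rewrite {1}[x]basE /y (exchange_big_dep xpredT) //.
rewrite [LHS]big_seq [RHS]big_seq; apply: eq_bigr => n; rewrite mem_iota /= add0n => n14.
have [ni|ni] := ltP (idg n) i.
  by rewrite x0 // scale0r big1 // => j _; rewrite scale0r.
have [j jn] : exists j : 'I_7, idg n = j%:Z - 3.
  have : all (fun n => has (fun j : nat => idg n == j%:Z - 3) (iota 0 7)) (iota 0 14) by [].
  have nin : n \in iota 0 14 by rewrite mem_iota.
  move=> /allP/(_ n nin)/hasP[j]; rewrite mem_iota => j7 /eqP.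
  by exists (Ordinal j7).
rewrite (bigD1 j) /=; last by rewrite -jn ni eqxx.
rewrite big1 ?addr0 // => k /andP[/andP[_ /eqP]]; rewrite jn => /addIr [jk].
by rewrite -val_eqE /= jk eqxx.
Qed.

End Coordinates.

(** * The Killing form *)

Definition zsum (s : seq nat) (F : nat -> Z) : Z := foldr (fun n z => (F n + z)%R) 0%R s.

Definition killing_sc (i j : nat) : Z :=
  zsum (iota 0 14) (fun k => zsum (iota 0 14) (fun l => sc i l k * sc j k l)).

Section Killing.
Variables (K : numFieldType) (r2 : K).
Hypothesis r2_sqr : r2 ^+ 2 = 2.
Local Notation g := 'cV[K]_14.
Local Notation "[ x , y ]" := (bracket r2 x y) (at level 0, x, y at level 200).
Local Notation bas := (@bas K).

Lemma zK_zsum s F : zK K (zsum s F) = \sum_(n <- s) zK K (F n).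
Proof.
elim: s => [|n s IH]; first by rewrite big_nil zK0.
by rewrite big_cons -IH [zsum _ _]/= zKD.
Qed.

Lemma ad_mul x y : ad r2 x *m y = [x, y].
Proof.
rewrite {2}[y]matrix_sum_delta linear_sum.
apply/colP => i; rewrite mxE summxE; apply: eq_bigr => j _.
by rewrite big_ord1 linearZ !mxE mulrC.
Qed.

Lemma mx_ext n (A B : 'M[K]_n) : (forall v : 'cV_n, A *m v = B *m v) -> A = B.
Proof. move=> AB; apply/matrixP => i j.
by have /colP/(_ i) := AB (delta_mx j 0); rewrite -!colE !mxE. Qed.

Lemma ad_is_linear : linear (ad r2).
Proof.
move=> a x y; apply: mx_ext => v.
by rewrite mulmxDl -scalemxAl !ad_mul bracketDl bracketZl.
Qed.
HB.instance Definition _ := GRing.isLinear.Build K g 'M[K]_14 _ (ad r2) ad_is_linear.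

Lemma ad_bracket x y : ad r2 [x, y] = ad r2 x *m ad r2 y - ad r2 y *m ad r2 x.
Proof.
apply: mx_ext => v; rewrite mulmxBl -!mulmxA !ad_mul.
have /eqP := jacobi r2_sqr x y v.
rewrite addr_eq0 -bracketC => /eqP <-; congr (_ + _).
by rewrite (bracketC r2 v x) linearN.
Qed.

Lemma killing_invariant x y z : killing r2 [x, y] z = killing r2 x [y, z].
Proof.
rewrite /killing !ad_bracket mulmxBl mulmxBr !linearB /= !mulmxA.
by congr (_ - _); rewrite -[in LHS]mulmxA mxtrace_mulC.
Qed.

Lemma killingC x y : killing r2 x y = killing r2 y x.
Proof. by rewrite /killing mxtrace_mulC. Qed.

Lemma killing_is_scalar x : scalar (killing r2 x).
Proof.
move=> a y z; rewrite /killing linearP mulmxDr -scalemxAr.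
by rewrite linearD linearZ.
Qed.
HB.instance Definition _ x := GRing.isLinear.Build K g K _ (killing r2 x) (killing_is_scalar x).

(** A trace over structure constants, hence computable with integers. *)
Lemma killing_bas i j : (i < 14)%N -> (j < 14)%N ->
  killing r2 (bas i) (bas j) = zK K (killing_sc i j).
Proof.
move=> i14 j14; rewrite /killing_sc zK_zsum /mxtrace.
rewrite -[iota 0 14]/(index_iota 0 14) big_mkord; apply: eq_bigr => k _.
rewrite mxE zK_zsum big_mkord; apply: eq_bigr => l _.
rewrite zKM -!(co_bracket_bas r2_sqr) // /co /bas !inord_val.
by congr (_ * _); rewrite [LHS]mxE.
Qed.

(** Duality is symmetric: the element of g_- dual to a basis vector of p_+ is the
    corresponding multiple of the basis vector of g_-. *)
Definition dual_pairs : seq (nat * nat * Z) :=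
  dual_neg ++ [seq (t.1.2, t.1.1, t.2) | t <- dual_neg].

Lemma killing_dual t n : t \in dual_pairs -> (n < 14)%N ->
  zK K t.2 / 24 * killing r2 (bas n) (bas t.1.1) = (n == t.1.2)%:R.
Proof.
move=> tin n14.
have : all (fun t => all (fun n => (t.1.1 < 14)%N &&
   (t.2 * killing_sc n t.1.1 == if n == t.1.2 then Zpos 24 else Z0)%R) (iota 0 14)) dual_pairs.
  by vm_compute.
have nin : n \in iota 0 14 by rewrite mem_iota.
move=> /allP/(_ t tin)/allP/(_ n nin)/andP[t14 /eqP kE].
rewrite killing_bas // mulrAC -zKM kE; case: eqP => _; last by rewrite zK0 mul0r.
have -> : zK K (Zpos 24) = 24 by [].
by rewrite divff // pnatr_eq0.
Qed.

Lemma killing_dualE t x : t \in dual_pairs ->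
  zK K t.2 / 24 * killing r2 x (bas t.1.1) = co x t.1.2.
Proof.
move=> tin; rewrite killingC {1}[x]basE linear_sum mulr_sumr.
have t14 : (t.1.2 < 14)%N by move: t tin; apply/allP.
rewrite (bigD1_seq t.1.2) ?mem_iota ?iota_uniq //=.
rewrite linearZ /= mulrCA killingC killing_dual // eqxx mulr1.
rewrite big_seq_cond big1 ?addr0 // => n /andP[]; rewrite (mem_iota 0 14) => /andP[_ n14] /negPf nt.
by rewrite linearZ /= mulrCA killingC killing_dual // nt mulr0.
Qed.

Lemma p_plus_dual X : p_plus r2 X ->
  X = \sum_(t <- dual_neg) (zK K t.2 / 24 * killing r2 X (bas t.1.1)) *: bas t.1.2.
Proof.
move=> /filtration_co X0; rewrite big_seq (eq_bigr (fun t => co X t.1.2 *: bas t.1.2)); last first.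
  by move=> t tin; rewrite killing_dualE // mem_cat tin.
rewrite -big_seq {1}[X]basE /dual_neg !big_cons !big_nil /=.
have c0 n : (n < 14)%N -> idg n < 1 -> co X n = 0 by move=> *; apply: X0.
by rewrite !(c0 0%N, c0 1%N, c0 2%N, c0 3%N, c0 4%N, c0 5%N, c0 6%N, c0 7%N, c0 9%N) // !scale0r !add0r.
Qed.

(** An element of p_+ is orthogonal to p, so as a linear form it is determined by
    its values on g_-. *)
Lemma p_plus_killing X x : p_plus r2 X ->
  killing r2 X x = \sum_(i <- neg) killing r2 X (bas i) * co x i.
Proof.
move=> Xp; rewrite {1}(p_plus_dual Xp) killingC linear_sum.
rewrite /neg -[[:: _; _; _; _; _]]/[seq t.1.1 | t <- dual_neg] big_map.
rewrite big_seq [RHS]big_seq; apply: eq_bigr => t tin.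
have tin' : (t.1.2, t.1.1, t.2) \in dual_pairs.
  by rewrite mem_cat (map_f (fun t => (t.1.2, t.1.1, t.2)) tin) orbT.
by rewrite linearZ /= -(killing_dualE x tin') mulrCA mulrA.
Qed.

End Killing.

(** * Normal cochains *)

Section Normality.
Variables (K : numFieldType) (r2 : K).
Hypothesis r2_sqr : r2 ^+ 2 = 2.
Local Notation g := 'cV[K]_14.
Local Notation "[ x , y ]" := (bracket r2 x y) (at level 0, x, y at level 200).
Local Notation bas := (@bas K).

(** The codifferential as a sum over the dual bases of g_- and p_+.  It is defined
    on all cochains, without reference to a decomposition into
    decomposables. *)
Definition codiff (phi : cochain2 K) : cochain1 K := fun x =>
  \sum_(t <- dual_neg) (zK K t.2 / 24) *:
    ([bas t.1.2, phi x (bas t.1.1)] + 2^-1 *: phi (bas t.1.1) [bas t.1.2, x]).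

(** The first two terms of the definition on decomposables come from expanding X
    and Y in the basis of p_+.  In the third, invariance of the Killing form
    moves the bracket [X, Y] to the argument; it does so in two ways, whence the
    factor 1/2. *)
Lemma codiff_wedge X Y v : p_plus r2 X -> p_plus r2 Y ->
  codiff (wedge_tens r2 X Y v) = codiff_tens r2 X Y v.
Proof.
move=> Xp Yp; apply/funext => x.
pose a (t : nat * nat * Z) := zK K t.2 / 24 * killing r2 X (bas t.1.1).
pose b (t : nat * nat * Z) := zK K t.2 / 24 * killing r2 Y (bas t.1.1).
have XE : X = \sum_(t <- dual_neg) a t *: bas t.1.2 by exact: p_plus_dual.
have YE : Y = \sum_(t <- dual_neg) b t *: bas t.1.2 by exact: p_plus_dual.
have brX z : [X, z] = \sum_(t <- dual_neg) a t *: [bas t.1.2, z].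
  by rewrite {1}XE bracket_suml; apply: eq_bigr => t _; rewrite bracketZl.
have brY z : [Y, z] = \sum_(t <- dual_neg) b t *: [bas t.1.2, z].
  by rewrite {1}YE bracket_suml; apply: eq_bigr => t _; rewrite bracketZl.
(* The average of the two expansions of the bracket [X, Y], along X and along Y. *)
have XY : killing r2 [X, Y] x =
    - 2^-1 * \sum_(t <- dual_neg) (a t * killing r2 Y [bas t.1.2, x] - b t * killing r2 X [bas t.1.2, x]).
  have -> : \sum_(t <- dual_neg) (a t * killing r2 Y [bas t.1.2, x] - b t * killing r2 X [bas t.1.2, x]) = 
    killing r2 Y [X, x] - killing r2 X [Y, x].
    rewrite sumrB brX brY [killing r2 Y _]linear_sum [killing r2 X _]linear_sum.
    by congr (_ - _); apply: eq_bigr => t _; rewrite linearZ.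
  rewrite -!(killing_invariant r2_sqr) (bracketC r2 Y X).
  rewrite (killingC r2 (- _)) linearN /= (killingC r2 x).
  by field.
have XYv : killing r2 [X, Y] x *: v = \sum_(t <- dual_neg)
    (- 2^-1 * (a t * killing r2 Y [bas t.1.2, x] - b t * killing r2 X [bas t.1.2, x])) *: v.
  by rewrite XY mulr_sumr scaler_suml.
rewrite /codiff_tens !fctE /tens brX brY XYv.
rewrite !scaler_sumr -!sumrN -!big_split /=.
apply: eq_bigr => t _; rewrite /wedge_tens /a /b [bracket _ _ (_ *: _)]linearZ /=.
apply: co_eq => n n14; rewrite !(coD, coN, coZ, coB).
move: (killing r2 X [_, x]) (killing r2 Y [_, x]) (killing r2 X (bas _)) (killing r2 Y (bas _))
  (killing r2 X x) (killing r2 Y x) (co [_, _] n) (co v n) (zK K t.2) => *.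
by field.
Qed.

Lemma cochain1_sumE I (s : seq I) (P : pred I) (F : I -> cochain1 K) x :
  (\sum_(i <- s | P i) F i) x = \sum_(i <- s | P i) F i x.
Proof. by rewrite fct_sumE. Qed.

Lemma cochain2_sumE I (s : seq I) (P : pred I) (F : I -> cochain2 K) x y :
  (\sum_(i <- s | P i) F i) x y = \sum_(i <- s | P i) F i x y.
Proof. by rewrite fct_sumE fct_sumE. Qed.

Lemma codiff_sum I (s : seq I) (F : I -> cochain2 K) :
  codiff (\sum_(i <- s) F i) = \sum_(i <- s) codiff (F i).
Proof.
apply/funext => x; rewrite cochain1_sumE /codiff [RHS]exchange_big /=.
apply: eq_bigr => t _; rewrite -scaler_sumr big_split /= -scaler_sumr.
by rewrite -linear_sum !cochain2_sumE.
Qed.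

Lemma codiff_ker phi : ker_codiff r2 phi -> codiff phi = 0.
Proof.
move=> [s [sp -> s0]]; rewrite codiff_sum [RHS]s0 big_seq [RHS]big_seq.
by apply: eq_bigr => t /sp[? ?]; exact: codiff_wedge.
Qed.

(** The cochain is the pull-back of an alternating bilinear map on g/p.  Written
    as an expansion over the pairs of basis vectors of g_-, this yields
    bilinearity, antisymmetry and the vanishing on p at once. *)
Definition horizontal (phi : cochain2 K) := forall x y,
  phi x y = \sum_(ij <- neg_pairs)
    (co x ij.1 * co y ij.2 - co x ij.2 * co y ij.1) *: phi (bas ij.1) (bas ij.2).

Lemma horizontal_sum I (s : seq I) (P : pred I) (F : I -> cochain2 K) :
  (forall i, P i -> horizontal (F i)) -> horizontal (\sum_(i <- s | P i) F i).
Proof.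
move=> FP x y; rewrite cochain2_sumE (eq_bigr _ (fun i Pi => FP i Pi x y)).
rewrite exchange_big /=; apply: eq_bigr => ij _.
by rewrite cochain2_sumE -scaler_sumr.
Qed.

Lemma wedge_minors (a b x y : nat -> K) :
  (\sum_(i <- neg) a i * x i) * (\sum_(i <- neg) b i * y i) -
  (\sum_(i <- neg) a i * y i) * (\sum_(i <- neg) b i * x i) =
  \sum_(ij <- neg_pairs) (x ij.1 * y ij.2 - x ij.2 * y ij.1) *
                         (a ij.1 * b ij.2 - a ij.2 * b ij.1).
Proof.
have -> : neg_pairs = [:: (2, 4); (2, 5); (2, 6); (2, 7); (4, 5); (4, 6); (4, 7);
  (5, 6); (5, 7); (6, 7)]%N by [].
by rewrite !big_cons !big_nil; ring.
Qed.

Lemma horizontal_wedge X Y v : p_plus r2 X -> p_plus r2 Y ->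
  horizontal (wedge_tens r2 X Y v).
Proof.
move=> Xp Yp x y; rewrite /wedge_tens.
rewrite (p_plus_killing r2_sqr x Xp) (p_plus_killing r2_sqr y Xp).
rewrite (p_plus_killing r2_sqr x Yp) (p_plus_killing r2_sqr y Yp).
rewrite (eq_bigr (fun ij => ((co x ij.1 * co y ij.2 - co x ij.2 * co y ij.1) *
   (killing r2 X (bas ij.1) * killing r2 Y (bas ij.2) -
    killing r2 X (bas ij.2) * killing r2 Y (bas ij.1))) *: v)); last first.
  by move=> ij _; rewrite scalerA.
rewrite -scaler_suml; congr (_ *: _).
exact: (wedge_minors (fun i => killing r2 X (bas i)) (fun i => killing r2 Y (bas i)) (co x) (co y)).
Qed.

Lemma horizontal_ker phi : ker_codiff r2 phi -> horizontal phi.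
Proof.
move=> [s [sp -> _]]; rewrite big_seq; apply: horizontal_sum => t /sp[? ?].
exact: horizontal_wedge.
Qed.

Section Horizontal.
Variable phi : cochain2 K.
Hypothesis hphi : horizontal phi.

Lemma horizontal_linear x : linear (phi x).
Proof.
move=> a y z; rewrite !(hphi x) scaler_sumr -big_split; apply: eq_bigr => ij _ /=.
by rewrite scalerA -scalerDl !coD !coZ; congr (_ *: _); ring.
Qed.

Lemma horizontal_antisym x y : phi x y = - phi y x.
Proof.
rewrite (hphi x) (hphi y) -sumrN; apply: eq_bigr => ij _.
by rewrite -[RHS]scaleNr opprB; congr (_ *: _); rewrite mulrC; congr (_ - _); rewrite mulrC.
Qed.

Lemma horizontal_expandr x y : phi x y = \sum_(n <- iota 0 14) co y n *: phi x (bas n).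
Proof.
pose f : {linear g -> g} := HB.pack (phi x) (GRing.isLinear.Build _ _ _ _ _ (horizontal_linear x)).
rewrite {1}[y]basE -[phi x _]/(f _) linear_sum; apply: eq_bigr => n _.
by rewrite linearZ.
Qed.

Lemma horizontal_expandl x y : phi x y = \sum_(n <- iota 0 14) co x n *: phi (bas n) y.
Proof.
rewrite horizontal_antisym horizontal_expandr -sumrN; apply: eq_bigr => n _.
by rewrite -scalerN -horizontal_antisym.
Qed.

Lemma horizontal_bas_neg i y : (i < 14)%N -> i \notin neg -> phi (bas i) y = 0.
Proof.
move=> i14 ineg; rewrite hphi big_seq big1 // => -[j k] jk /=.
have /andP[jin kin] : (j \in neg) && (k \in neg).
  by move: jk; rewrite mem_filter => /andP[_ /allpairsP[[? ?] [? ? [-> ->]]]]; apply/andP.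
have c0 l : l \in neg -> co (bas i) l = 0.
  move=> lin; rewrite co_bas; [|by []|by move: l lin; apply/allP].
  by case: eqP => // il; rewrite il lin in ineg.
by rewrite !c0 // !mul0r subrr scale0r.
Qed.

End Horizontal.

End Normality.

Section Forms.
Variables (K : numFieldType) (V : lmodType K) (v : seq nat -> V).

Lemma ev_scale c r : ev v (scale c r) = zK K c *: ev v r.
Proof.
elim: r => [|[d x] r IH]; first by rewrite /= ev_nil scaler0.
by rewrite /= !ev_cons IH scalerDr scalerA -zKM.
Qed.

Lemma ev_flatten (rs : seq lform) : ev v (flatten rs) = \sum_(r <- rs) ev v r.
Proof.
elim: rs => [|r rs IH]; first by rewrite big_nil ev_nil.
by rewrite big_cons -IH /= ev_cat.
Qed.

Lemma ev_lsum s F : ev v (lsum s F) = \sum_(i <- s) ev v (F i).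
Proof. by rewrite /lsum ev_flatten big_map. Qed.

Lemma ev_prefix p r : ev v (prefix_form p r) = ev (fun x => v (p ++ x)) r.
Proof. by rewrite /ev big_map. Qed.

End Forms.

Section NormalCochains.
Variables (K : numFieldType) (r2 : K).
Hypothesis r2_sqr : r2 ^+ 2 = 2.
Local Notation g := 'cV[K]_14.
Local Notation "[ x , y ]" := (bracket r2 x y) (at level 0, x, y at level 200).
Local Notation bas := (@bas K).

Definition positive (phi : cochain2 K) := forall i j k,
  (i < 14)%N -> (j < 14)%N -> (k < 14)%N -> Z.ltb Z0 (vdeg i j k) = false ->
  co (phi (bas i) (bas j)) k = 0.

Lemma bracket_Z1_bas i : (i < 14)%N -> [Z1 K, bas i] = (idg i)%:~R *: bas i.
Proof.
move=> i14; apply: co_eq => n n14; rewrite co_bracketZ1 // coZ co_bas //.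
by case: eqP => [->|]; rewrite ?mulr0.
Qed.

(** An eigencochain of Z1 has components only in the degree equal to its
    eigenvalue. *)
Lemma positive_eigen (phi : cochain2 K) (lam : K) : horizontal phi -> 0 < lam ->
  lie_action r2 (Z1 K) phi = lam *: phi -> positive phi.
Proof.
move=> hphi lam0 phil i j k i14 j14 k14 dijk.
have := congr1 (fun f => co (f (bas i) (bas j)) k) phil.
rewrite /lie_action !bracket_Z1_bas // (horizontal_antisym hphi (_ *: _)).
have lin x a y : phi x (a *: y) = a *: phi x y.
  have := horizontal_linear hphi x a y 0; rewrite addr0 (horizontal_expandr hphi x 0).
  by rewrite big1 ?addr0 // => n _; rewrite co0 scale0r.
rewrite !lin -scalerN -(horizontal_antisym hphi) !fctE /= !coB !coZ co_bracketZ1 //.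
rewrite -!mulrBl => /eqP; rewrite -subr_eq0 -mulrBl mulf_eq0 => /orP[|/eqP //].
rewrite -!intrB subr_eq0 => /eqP lamE; move: lam0; rewrite -lamE ltr0z.
by move: dijk; rewrite /vdeg /idg; lia.
Qed.

Definition normal (phi : cochain2 K) :=
  [/\ horizontal phi, positive phi & codiff r2 phi = 0].

Lemma normal_ker1 phi : ker_codiff1 r2 phi -> normal phi.
Proof.
move=> [n [lam [psi [psiP ->]]]].
have hpsi i : horizontal (psi i) by have [_ /(horizontal_ker r2_sqr)] := psiP i.
split.
- by apply: horizontal_sum.
- move=> i j k i14 j14 k14 dijk; rewrite cochain2_sumE co_sum big1 // => l _.
  by have [lam0 _ psil] := psiP l; apply: (positive_eigen (hpsi l) lam0 psil).
- rewrite codiff_sum big1 // => l _.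
  by have [_ /(codiff_ker r2_sqr)] := psiP l.
Qed.

Definition val2 (phi : cochain2 K) (v : seq nat) : K^o :=
  if v is [:: i; j; k] then co (phi (bas i) (bas j)) k else 0.

(** Words of other lengths are unconstrained: they may carry derivatives. *)
Definition represents (v : seq nat -> K^o) (phi : cochain2 K) :=
  forall i j k, v [:: i; j; k] = co (phi (bas i) (bas j)) k.

Lemma represents_val2 phi : represents (val2 phi) phi. Proof. by []. Qed.

Lemma ev_alt v phi i j k : represents v phi -> horizontal phi ->
  ev v (alt i j k) = co (phi (bas i) (bas j)) k.
Proof.
move=> vphi hphi; rewrite /alt; case: ltngtP => [ij|ij|->].
- by rewrite ev_cons ev_nil zK1 scale1r addr0 vphi.
- rewrite ev_cons ev_nil (zKN K 1) zK1 scaleN1r addr0 vphi.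
  by rewrite (horizontal_antisym hphi) coN opprK.
- rewrite ev_nil; have /eqP := horizontal_antisym hphi (bas j) (bas j).
  by rewrite -addr_eq0 -mulr2n -scaler_nat scaler_eq0 pnatr_eq0 => /eqP ->; rewrite co0.
Qed.

Lemma ev_component v phi i j k : represents v phi -> horizontal phi -> positive phi ->
  (i < 14)%N -> (j < 14)%N -> (k < 14)%N ->
  ev v (component i j k) = co (phi (bas i) (bas j)) k.
Proof.
move=> vphi hphi pphi i14 j14 k14; rewrite /component.
case: (boolP (i \in neg)) => [_|ineg]; last first.
  by rewrite ev_nil (horizontal_bas_neg hphi) // co0.
case: (boolP (j \in neg)) => [_|jneg] /=; last first.
  by rewrite ev_nil (horizontal_antisym hphi) (horizontal_bas_neg hphi) // oppr0 co0.
case: ifP => [_|dijk]; first exact: ev_alt.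
by rewrite ev_nil pphi.
Qed.

Lemma ev_codiff_row v phi j m : represents v phi -> normal phi -> (j < 14)%N -> (m < 14)%N ->
  ev v (codiff_row j m) = 0.
Proof.
move=> vphi [hphi pphi cphi] j14 m14.
suff -> : ev v (codiff_row j m) = 48 * co (codiff r2 phi (bas j)) m.
  by rewrite cphi -[_ (bas j)]/(0 : g) co0 mulr0.
rewrite /codiff_row ev_flatten big_map /codiff co_sum mulr_sumr.
rewrite big_seq [RHS]big_seq; apply: eq_bigr => -[[i i'] w] tin /=.
have /andP[i14 i'14] : (i < 14)%N && (i' < 14)%N.
  by have /allP/(_ _ tin) : all (fun t => (t.1.1 < 14)%N && (t.1.2 < 14)%N) dual_neg by [].
rewrite ev_cat !ev_lsum coZ coD coZ co_bracketl // (horizontal_expandr hphi _ [_, _]) co_sum.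
have -> (s t : K) : 48 * (zK K w / 24 * (s + 2^-1 * t)) = 2 * zK K w * s + zK K w * t by field.
rewrite !mulr_sumr; congr (_ + _); rewrite big_seq [RHS]big_seq; apply: eq_bigr => k;
  rewrite (mem_iota 0 14) add0n /= => k14.
  rewrite ev_scale (ev_component vphi) // !zKM -[_ *: _]/(_ * _).
  by rewrite (_ : zK K 2%R = 2) // mulrA.
by rewrite ev_scale (ev_component vphi) // !zKM -[_ *: _]/(_ * _) coZ co_bracket_bas // mulrA.
Qed.

End NormalCochains.

(** * One degree of the induction *)

Section Induction.
Variables (K : numFieldType) (r2 : K).
Hypothesis r2_sqr : r2 ^+ 2 = 2.
Local Notation g := 'cV[K]_14.
Local Notation "[ x , y ]" := (bracket r2 x y) (at level 0, x, y at level 200).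
Local Notation bas := (@bas K).

(** Agreement below degree [l] with an element of the span of [Ebasis]. *)
Definition in_E_below (l : Z) (phi : cochain2 K) := forall i j k,
  (i, j, k) \in vars -> Z.lt (vdeg i j k) l ->
  co (phi (bas i) (bas j)) k = ev (val2 phi) (expand [:: i; j; k]).

Lemma component_vars i j k t : (k < 14)%N -> t \in component i j k ->
  exists i' j', [/\ t.2 = [:: i'; j'; k], (i', j', k) \in vars
                   & vdeg i' j' k = vdeg i j k].
Proof.
move=> k14; rewrite /component; case: (boolP (i \in neg)) => //= ineg.
case: (boolP (j \in neg)) => //= jneg; case: ifP => // _.
have inv a b : a \in neg -> b \in neg -> (a < b)%N -> (a, b, k) \in vars.
  move=> an bn ab; apply/allpairsP; exists ((a, b), k).
  by rewrite mem_iota mem_filter ab allpairs_f.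
rewrite /alt; case: ltngtP => // ij; rewrite inE => /eqP ->.
  by exists i, j; split=> //; apply: inv.
by exists j, i; split=> //; [apply: inv|rewrite /vdeg; lia].
Qed.

Lemma ev_component_expand l phi i j k : horizontal phi -> positive phi -> in_E_below l phi ->
  (i < 14)%N -> (j < 14)%N -> (k < 14)%N -> Z.lt (vdeg i j k) l ->
  co (phi (bas i) (bas j)) k = \sum_(t <- component i j k) zK K t.1 *: ev (val2 phi) (expand t.2).
Proof.
move=> hphi pphi El i14 j14 k14 ijl.
rewrite -(ev_component (@represents_val2 _ phi) hphi pphi) // /ev big_seq [RHS]big_seq.
apply: eq_bigr => t /(component_vars k14)[i' [j' [-> ijv ijd]]]; congr (_ *: _).
by apply: El => //; rewrite ijd.
Qed.

(** No line of [Ebasis] contains a component with values in g_-. *)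
Lemma torsion_vanish l phi i j k : horizontal phi -> positive phi -> in_E_below l phi ->
  (i < 14)%N -> (j < 14)%N -> k \in neg -> Z.lt (vdeg i j k) l ->
  co (phi (bas i) (bas j)) k = 0.
Proof.
move=> hphi pphi El i14 j14 kneg ijl.
have k14 : (k < 14)%N by move: k kneg {ijl}; apply/allP.
rewrite (ev_component_expand hphi pphi El) // big_seq big1 // => t /(component_vars k14)[i' [j' [-> ijv _]]].
have : all (fun v : nat * nat * nat => (v.2 \in neg) ==>
   nilp (expand [:: v.1.1; v.1.2; v.2])) vars by vm_compute.
by move=> /allP/(_ _ ijv)/implyP/(_ kneg)/nilP ->; rewrite ev_nil scaler0.
Qed.

Lemma ev_expand v w x : (forall i j k, v [:: i; j; k] = w [:: i; j; k] :> K^o) ->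
  ev v (expand x) = ev w (expand x).
Proof.
move=> vw; rewrite /ev /expand !big_map; rewrite big_seq_cond [RHS]big_seq_cond.
apply: eq_bigr => b; rewrite andbT mem_filter => /andP[_ bE] /=; congr (_ *: _).
have : all (fun b : lform => if (head (Z0, [::]) b).2 is [:: i; j; k] then true else false) Ebasis by [].
by move=> /allP/(_ b bE); case: (head _ b).2 => [|i [|j [|k []]]].
Qed.

Variables (phi : cochain2 K) (dphi : nat -> cochain2 K) (l : Z).
Hypothesis phi_normal : normal r2 phi.
Hypothesis dphi_horizontal : forall a, a \in neg -> horizontal (dphi a).
Hypothesis dphi_positive : forall a, a \in neg -> positive (dphi a).
Hypothesis phi_E : in_E_below l phi.
Hypothesis dphi_E : forall a, a \in neg -> in_E_below l (dphi a).

Definition bianchi_term (x y z : nat) : g :=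
  [bas x, phi (bas y) (bas z)] - phi [bas x, bas y] (bas z) +
  phi (phi (bas x) (bas y)) (bas z) + dphi x (bas y) (bas z).

Hypothesis bianchi : forall a b c, a \in neg -> b \in neg -> c \in neg ->
  bianchi_term a b c + bianchi_term b c a + bianchi_term c a b = 0.

(** The assignment for which the rows of the linear system are true equations:
    the components of [phi] and those of its derivatives. *)
Definition val3 (v : seq nat) : K^o :=
  if v is [:: a; i; j; k] then val2 (dphi a) [:: i; j; k] else val2 phi v.

Lemma neg14 a : a \in neg -> (a < 14)%N.
Proof. by move: a; apply/allP. Qed.

Lemma dg_neg a : a \in neg -> Z.lt (dg a) Z0.
Proof. by move=> an; apply/Z.ltb_spec0; move: a an; apply/allP. Qed.

Lemma ev_bracket_value v a b c m : represents v phi -> (a < 14)%N -> (b < 14)%N -> (c < 14)%N -> (m < 14)%N ->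
  \sum_(k <- iota 0 14) ev v (scale (sc a k m) (component b c k)) =
  co [bas a, phi (bas b) (bas c)] m.
Proof.
have [hphi pphi _] := phi_normal => vphi a14 b14 c14 m14.
rewrite co_bracketl // big_seq [RHS]big_seq; apply: eq_bigr => k.
by rewrite (mem_iota 0 14) => k14; rewrite ev_scale (ev_component vphi).
Qed.

Lemma ev_value_bracket v a b c m : represents v phi -> (a < 14)%N -> (b < 14)%N -> (c < 14)%N -> (m < 14)%N ->
  \sum_(d <- iota 0 14) ev v (scale (- sc a b d)%R (component d c m)) =
  - co (phi [bas a, bas b] (bas c)) m.
Proof.
have [hphi pphi _] := phi_normal => vphi a14 b14 c14 m14.
rewrite (horizontal_expandl hphi) co_sum -sumrN big_seq [RHS]big_seq; apply: eq_bigr => d.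
rewrite (mem_iota 0 14) => d14; rewrite ev_scale (ev_component vphi) //.
by rewrite zKN coZ co_bracket_bas // -[_ *: _]/(_ * _) mulNr.
Qed.

(** The derivatives inherit the equations of the span in degree less than [l], so
    they may be replaced by derivatives of pivot components. *)
Lemma ev_derivative a b c m : a \in neg -> (b < 14)%N -> (c < 14)%N -> (m < 14)%N ->
  Z.lt (vdeg b c m) l ->
  ev val3 (prefix_form [:: a] (flatten [seq scale t.1 (expand t.2) | t <- component b c m])) =
  co (dphi a (bas b) (bas c)) m.
Proof.
move=> an b14 c14 m14 bcl.
rewrite (ev_component_expand (dphi_horizontal an) (dphi_positive an) (dphi_E an)) //.
rewrite ev_prefix ev_flatten big_map; apply: eq_bigr => t _.
by rewrite ev_scale; congr (_ *: _); exact: ev_expand.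
Qed.

(** Expand the inner value along g_-.  Each term is a product of a component of
    [phi] with values in g_- and another component of [phi], of degrees that add
    up to [l].  Since the second has positive degree, the first has degree less
    than [l], where [phi] is torsion-free. *)
Lemma quadratic_vanish a b c m : a \in neg -> b \in neg -> (m < 14)%N ->
  (c < 14)%N -> (dg m - dg a - dg b - dg c)%Z = l ->
  co (phi (phi (bas a) (bas b)) (bas c)) m = 0.
Proof.
have [hphi pphi _] := phi_normal.
move=> an bn m14 c14 degl.
rewrite (horizontal_expandl hphi) co_sum big_seq big1 // => d.
rewrite (mem_iota 0 14) => d14; rewrite coZ.
case: (boolP (d \in neg)) => [dn|dn]; last first.
  by rewrite (horizontal_bas_neg hphi (i := d)) // co0 mulr0.
case dcm : (Z.ltb Z0 (vdeg d c m)); last by rewrite (pphi d c m) // mulr0.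
rewrite (torsion_vanish hphi pphi phi_E) ?mul0r // ?neg14 //.
by move: dcm; rewrite /vdeg; lia.
Qed.

Lemma ev_bianchi_part a b c m : a \in neg -> b \in neg -> c \in neg -> (m < 14)%N ->
  (dg m - dg a - dg b - dg c)%Z = l ->
  ev val3 (bianchi_part a b c m) = co (bianchi_term a b c) m.
Proof.
move=> an bn cn m14 degl; have a14 := neg14 an; have b14 := neg14 bn; have c14 := neg14 cn.
have vphi : represents val3 phi by [].
(* The direction of differentiation has negative degree. *)
have bcl : Z.lt (vdeg b c m) l by have := dg_neg an; rewrite /vdeg; lia.
have e1 := ev_bracket_value vphi a14 b14 c14 m14.
have e2 := ev_value_bracket vphi a14 b14 c14 m14.
have e3 := ev_derivative an b14 c14 m14 bcl.
rewrite /bianchi_part ev_cat ev_lsum e1 ev_cat ev_lsum e2 e3.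
rewrite /bianchi_term !coD coN quadratic_vanish //.
by rewrite addr0 addrA.
Qed.

Lemma ev_bianchi_row a b c m : a \in neg -> b \in neg -> c \in neg -> (m < 14)%N ->
  (dg m - dg a - dg b - dg c)%Z = l -> ev val3 (bianchi_row a b c m) = 0.
Proof.
move=> an bn cn m14 degl; rewrite /bianchi_row ev_cat ev_bianchi_part // ev_cat.
rewrite (ev_bianchi_part bn cn an) //; last by lia.
rewrite (ev_bianchi_part cn an bn) //; last by lia.
by rewrite addrA -[RHS](co0 _ m) -(bianchi an bn cn) 2!coD.
Qed.

(** All rows of the system in degree [l] vanish on the components of [phi] and
    its derivatives; therefore so do the targets, which are the equations of the
    span in degree [l]. *)
Lemma in_E_step : check_step l -> in_E_below (Z.succ l) phi.
Proof.
move=> chk i j k ijk ijl.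
have [ijl'|ijl'] := Z.lt_ge_cases (vdeg i j k) l; first exact: phi_E.
have ijE : vdeg i j k = l by lia.
have SD (a x y : K^o) : x = 0 -> y = 0 -> a *: x + y = 0.
  by move=> -> ->; rewrite scaler0 addr0.
have check := @in_span_sound K _ K^o val3 (fun z => z = 0) erefl SD _ _ chk.
have /eqP : ev val3 (target i j k) = 0.
  apply: check => [p|]; last first.
    by apply/mapP; exists (i, j, k) => //; rewrite mem_filter ijE /= ijk andbT.
  rewrite mem_cat => /orP[|] /mapP[v]; rewrite mem_filter => /andP[vl vin] ->.
    case/allpairsP: vin => -[x y] [/= xn]; rewrite (mem_iota 0 14) => yn ->.
    by apply: (ev_codiff_row r2_sqr (phi := phi)) => //; exact: neg14.
  case/andP: vl => _ /eqP degl.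
  case/allpairsP: vin degl => -[abc m] [abcn]; rewrite [snd _]/= (mem_iota 0 14) => mn -> degl.
  case/allpairsP: abcn degl => -[[a b] c] [abn cn abcE] degl; rewrite abcE /= in degl *.
  have /andP[an bn] : (a \in neg) && (b \in neg).
    by move: abn; rewrite mem_filter => /andP[_ /allpairsP[[? ?] [? ? [-> ->]]]]; apply/andP.
  exact: ev_bianchi_row.
rewrite ev_cons zK1 scale1r ev_scale (zKN K 1) zK1 scaleN1r subr_eq0 => /eqP.
by rewrite (ev_expand (w := val2 phi)) // => <-.
Qed.

End Induction.

(** * P-submodules are stable under nilpotent elements of the Lie algebra *)

Section PolynomialFamilies.
Variables (K : numFieldType) (V : lmodType K) (S : V -> Prop).
Hypothesis S0 : S 0.
Hypothesis SD : forall a x y, S x -> S y -> S (a *: x + y).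

(** Let f(t) be a polynomial of degree N with values in the subspace.  Then
    f(2t) - 2^N f(t) has degree less than N, with coefficients that are nonzero
    multiples of those of f because 2^n differs from 2^N in characteristic 0;
    induction on N applies. *)
Lemma subspace_coefficients N (w : nat -> V) :
  (forall t : K, S (\sum_(n < N) t ^+ n *: w n)) -> forall n, (n < N)%N -> S (w n).
Proof.
elim: N w => [//|N IH] w Sw.
have SZ a x : S x -> S (a *: x) by apply: subspaceZ.
have lower n : (n < N)%N -> S (w n).
  move=> nN; have d0 : (2 ^+ n - 2 ^+ N : K) != 0.
    by rewrite subr_eq0 -!natrX eqr_nat eqn_exp2l // ltn_eqF.
  rewrite -[w n](scalerK d0); apply: SZ.
  apply: (IH (fun n => (2 ^+ n - 2 ^+ N) *: w n)) => // t.
  have := SD (- 2 ^+ N) (Sw t) (Sw (2 * t)).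
  rewrite scaler_sumr -big_split /= big_ord_recr /= exprMn.
  rewrite !scalerA -scalerDl mulNr addNr scale0r addr0.
  congr S; apply: eq_bigr => m _; rewrite !scalerA -scalerDl; congr (_ *: _).
  by rewrite exprMn; ring.
move=> n; rewrite ltnS leq_eqVlt => /predU1P[->|]; last exact: lower.
have := Sw 1; rewrite big_ord_recr /= expr1n scale1r => SN.
rewrite -[w N](addKr (\sum_(i < N) 1 ^+ i *: w i)) -scaleN1r.
apply: SD SN; apply: subspace_sum => // i _.
by apply: SZ; apply: lower.
Qed.

End PolynomialFamilies.

Section Exponential.
Variables (K : numFieldType) (d : nat) (N : 'M[K]_d.+1).
Hypothesis N4 : N ^+ 4 = 0.

Definition exp4 (t : K) : 'M[K]_d.+1 := \sum_(k < 4) (t ^+ k / k`!%:R) *: N ^+ k.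

Lemma nilpotent_mul (a b : nat -> K) :
  (\sum_(k < 4) a k *: N ^+ k) * (\sum_(k < 4) b k *: N ^+ k) =
  (a 0%N * b 0%N) *: N ^+ 0 + (a 0%N * b 1%N + a 1%N * b 0%N) *: N ^+ 1 +
  (a 0%N * b 2%N + a 1%N * b 1%N + a 2%N * b 0%N) *: N ^+ 2 +
  (a 0%N * b 3%N + a 1%N * b 2%N + a 2%N * b 1%N + a 3%N * b 0%N) *: N ^+ 3.
Proof.
have NN k l : N ^+ k * N ^+ l = if (k + l < 4)%N then N ^+ (k + l) else 0.
  rewrite -exprD; case: ltnP => // kl.
  by rewrite -[in LHS](subnKC kl) exprD N4 mul0r.
rewrite !big_ord_recr !big_ord0 /= !add0r.
rewrite !mulrDl !mulrDr -!scalerAl -!scalerAr !scalerA !NN /= !scaler0 !addr0.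
move: (N ^+ 0) (N ^+ 1) (N ^+ 2) (N ^+ 3) => A B C D.
apply/matrixP => i j; rewrite !mxE; ring.
Qed.

Lemma exp4_mul t : exp4 t * exp4 (- t) = 1.
Proof.
have f2 : 2 != 0 :> K by rewrite pnatr_eq0.
have f3 : 3 != 0 :> K by rewrite pnatr_eq0.
rewrite /exp4 (nilpotent_mul (fun k => t ^+ k / k`!%:R) (fun k => (- t) ^+ k / k`!%:R)).
rewrite !factS fact0 !(expr0, expr1).
have c0 (c : K) M : c = 0 -> c *: M = 0 :> 'M[K]_d.+1 by move=> ->; rewrite scale0r.
rewrite (c0 _ N) ?(c0 _ (N ^+ 2)) ?(c0 _ (N ^+ 3)) ?addr0; try by field.
by rewrite divr1 mulr1 scale1r.
Qed.

Lemma expmx_nilpotent t : expmx (t *: N) = exp4 t.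
Proof.
rewrite /expmx; apply/cvg_lim => //.
apply: cvg_near_cst; exists 4%N => // n /= n4.
rewrite /series /= -(subnKC n4) /index_iota subn0 iotaD big_cat /=.
rewrite [X in _ + X]big1_seq ?addr0; last first.
  move=> m /andP[_]; rewrite mem_iota add0n => /andP[m4 _].
  have Nm : N ^+ m = 0 by rewrite -(subnKC m4) exprD N4 mul0r.
  by rewrite exprZn Nm !scaler0.
rewrite /exp4 -(big_mkord xpredT (fun k => (t ^+ k / k`!%:R) *: N ^+ k)).
by apply: eq_bigr => k _; rewrite exprZn scalerA mulrC.
Qed.

End Exponential.

Section LieStability.
Variables (K : numFieldType) (r2 : K).
Hypothesis r2_sqr : r2 ^+ 2 = 2.
Local Notation g := 'cV[K]_14.
Local Notation "[ x , y ]" := (bracket r2 x y) (at level 0, x, y at level 200).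

Definition bilinear_cochain (phi : cochain2 K) :=
  (forall x, linear (phi x)) /\ (forall y, linear (phi^~ y)).

Lemma bilinear_cochain_sum phi (c d : 'I_4 -> K) (u v : 'I_4 -> g) : bilinear_cochain phi ->
  phi (\sum_b c b *: u b) (\sum_b d b *: v b) =
  \sum_b \sum_b' (c b * d b') *: phi (u b) (v b').
Proof.
move=> [lr ll].
pose f y : {linear g -> g} := HB.pack (phi^~ y) (GRing.isLinear.Build _ _ _ _ _ (ll y)).
pose h x : {linear g -> g} := HB.pack (phi x) (GRing.isLinear.Build _ _ _ _ _ (lr x)).
have hE b : phi (u b) (\sum_b d b *: v b) = \sum_b' d b' *: phi (u b) (v b').
  by rewrite -[LHS]/(h (u b) _) linear_sum; apply: eq_bigr => b' _; rewrite linearZ.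
rewrite -[LHS]/(f (\sum_b d b *: v b) _) linear_sum; apply: eq_bigr => b _.
rewrite linearZ /= hE scaler_sumr; apply: eq_bigr => b' _.
by rewrite scalerA.
Qed.

(** The action of exp(t ad X) on [phi] is a polynomial in t: both the value and
    the two arguments contribute powers of [ad X] below 4, so its degree is at
    most 9.  Its coefficients lie in the submodule, and the coefficient of t is
    the Lie derivative. *)
Lemma P_submodule_lie (V : set (cochain2 K)) (X : g) phi :
  P_submodule r2 V -> parabolic r2 X -> ad r2 X ^+ 4 = 0 ->
  bilinear_cochain phi -> V phi -> V (lie_action r2 X phi).
Proof.
move=> [V0 VD VP] Xp N4 bphi Vphi; set N := ad r2 X in N4 *.
pose W a b c : cochain2 K := fun x y => N ^+ a *m phi (N ^+ b *m x) (N ^+ c *m y).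
(* The signs come from the inverse of exp(t ad X), which is exp(- t ad X) and acts
   on the arguments. *)
pose q (a b c : nat) : K := (-1) ^+ (b + c) / (a`! * b`! * c`!)%:R.
pose w (n : nat) : cochain2 K := \sum_(a < 4) \sum_(b < 4) \sum_(c < 4)
  if (a + b + c == n)%N then q a b c *: W a b c else 0.
have Vw : forall n, (n < 10)%N -> V (w n).
  apply: subspace_coefficients => // t.
  have tX : parabolic r2 (t *: X).
    apply: co_filtration => // n n14 dn.
    by rewrite coZ (filtration_co r2_sqr Xp) // mulr0.
  have := VP _ _ (P1_exp tX) Vphi.
  rewrite linearZ /= -/N expmx_nilpotent //.
  have inv : invmx (exp4 N t) = exp4 N (- t).
    have E1 := exp4_mul N4 t.
    rewrite -[LHS]mulmx1 -[1%:M]/(1 : 'M[K]_14) -E1 -[_ * _]/(_ *m _) mulmxA.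
    by rewrite mulVmx ?mul1mx //; have [] := mulmx1_unit E1.
  have expv (s : K) (v : g) : exp4 N s *m v = \sum_(k < 4) (s ^+ k / k`!%:R) *: (N ^+ k *m v).
    by rewrite mulmx_suml; apply: eq_bigr => k _; rewrite scalemxAl.
  congr V; apply/funext => x; apply/funext => y.
  rewrite /group_action inv !expv bilinear_cochain_sum //.
  rewrite cochain2_sumE /w.
  have -> : \sum_(n < 10) (t ^+ n *: w n) x y = \sum_(a < 4) \sum_(b < 4) \sum_(c < 4)
      (t ^+ (a + b + c) * q a b c) *: W a b c x y.
    rewrite (eq_bigr (fun n : 'I_10 => \sum_(a < 4) \sum_(b < 4) \sum_(c < 4)
      if (a + b + c == n)%N then (t ^+ n * q a b c) *: W a b c x y else 0)); last first.
      move=> n _; rewrite -[LHS]/(t ^+ n *: (w n x y)) /w cochain2_sumE scaler_sumr.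
      apply: eq_bigr => a _; rewrite cochain2_sumE scaler_sumr.
      apply: eq_bigr => b _; rewrite cochain2_sumE scaler_sumr.
      apply: eq_bigr => c _; case: ifP => _; last by rewrite scaler0.
      by rewrite -[(_ *: W _ _ _) x y]/(q a b c *: W a b c x y) scalerA.
    rewrite exchange_big; apply: eq_bigr => a _.
    rewrite exchange_big; apply: eq_bigr => b _.
    rewrite exchange_big; apply: eq_bigr => c _.
    have abc : (a + b + c < 10)%N.
      by have := ltn_ord a; have := ltn_ord b; have := ltn_ord c; lia.
    rewrite (bigD1 (Ordinal abc)) //= eqxx big1 ?addr0 // => n /negPf nabc.
    by rewrite -val_eqE /= eq_sym in nabc; rewrite nabc.
  apply: eq_bigr => a _.
  rewrite linear_sum scaler_sumr; apply: eq_bigr => b _.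
  rewrite linear_sum scaler_sumr; apply: eq_bigr => c _.
  rewrite /W /q linearZ /= !scalerA; congr (_ *: _).
  rewrite (exprNn t b) (exprNn t c) !exprD !natrM.
  have fa n : n`!%:R != 0 :> K by rewrite pnatr_eq0 -lt0n fact_gt0.
  have fa' := fa a; have fb' := fa b; have fc' := fa c; clear fa.
  move: (a`!%:R) (b`!%:R) (c`!%:R) (t ^+ a) (t ^+ b) (t ^+ c) ((-1) ^+ b) ((-1) ^+ c) fa' fb' fc'.
  by move=> u1 u2 u3 u4 u5 u6 u7 u8 fa fb fc; field; rewrite fa fb fc.
suff -> : lie_action r2 X phi = w 1 by exact: Vw.
rewrite /w; do 3! rewrite ?big_ord_recl ?big_ord0 /=.
rewrite !(addr0, add0r) /q /W /bump /= !fact0 !factS fact0 !muln1 /=.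
rewrite !expr0 !expr1 !divr1 scale1r !scaleN1r.
apply/funext => x; apply/funext => y.
rewrite /lie_action !fctE /= !mul1mx /N !ad_mul.
by rewrite addrC addrA addrAC.
Qed.

End LieStability.

(** * The basis cochains lie in the curvature module *)

Section CurvatureModule.
Variables (K : numFieldType) (r2 : K).
Hypothesis r2_sqr : r2 ^+ 2 = 2.
Local Notation g := 'cV[K]_14.
Local Notation "[ x , y ]" := (bracket r2 x y) (at level 0, x, y at level 200).
Local Notation bas := (@bas K).

(** Indexed by words, like the components, so that evaluating forms at [eps]
    produces cochains. *)
Definition eps (v : seq nat) : cochain2 K := fun x y =>
  if v is [:: i; j; k] then (co x i * co y j - co x j * co y i) *: bas k else 0.

Lemma eps_bilinear v : bilinear_cochain (eps v).
Proof.
have b0 : bilinear_cochain (fun _ _ : g => 0 : g).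
  by split=> x a y z; rewrite scaler0 addr0.
case: v => [|i [|j [|k [|l v]]]] //.
by split=> x a y z; rewrite /eps !coD !coZ scalerA -scalerDl; congr (_ *: _); ring.
Qed.

Lemma ev_bilinear r : bilinear_cochain (ev eps r).
Proof.
have evE x y : ev eps r x y = \sum_(t <- r) zK K t.1 *: eps t.2 x y.
  by rewrite /ev cochain2_sumE.
split=> [x|y] a z z'; rewrite !evE scaler_sumr -big_split; apply: eq_bigr => t _ /=.
  by rewrite (eps_bilinear t.2).1 scalerDr !scalerA mulrC.
by rewrite (eps_bilinear t.2).2 scalerDr !scalerA mulrC.
Qed.

Lemma ev_eps_alt i j k : ev eps (alt i j k) = eps [:: i; j; k].
Proof.
rewrite /alt; case: ltngtP => [ij|ij|->].
- by rewrite ev_cons ev_nil zK1 scale1r addr0.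
- rewrite ev_cons ev_nil (zKN K 1) zK1 scaleN1r addr0.
  apply/funext => x; apply/funext => y; rewrite !fctE /eps -scaleNr opprB.
  by congr (_ *: _); rewrite mulrC; congr (_ - _); rewrite mulrC.
- rewrite ev_nil; apply/funext => x; apply/funext => y.
  by rewrite /eps mulrC subrr scale0r.
Qed.

Lemma lie_action_eps a i j k : (a < 14)%N -> (i < 14)%N -> (j < 14)%N -> (k < 14)%N ->
  lie_action r2 (bas a) (eps [:: i; j; k]) = ev eps (act_mono a i j k).
Proof.
move=> a14 i14 j14 k14.
rewrite /act_mono ev_cat ev_lsum ev_cat !ev_lsum.
have lsE (F : nat -> Z) G x y : (\sum_(d <- iota 0 14) ev eps (scale (F d) (G d))) x y =
    \sum_(d <- iota 0 14) zK K (F d) *: ev eps (G d) x y.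
  by rewrite cochain2_sumE; apply: eq_bigr => d _; rewrite ev_scale.
apply/funext => x; apply/funext => y; rewrite /lie_action.
rewrite -[RHS]/(_ x y + (_ x y + _ x y)) !lsE.
have brE : [bas a, bas k] = \sum_(l <- iota 0 14) zK K (sc a k l) *: bas l.
  rewrite [LHS]basE big_seq [RHS]big_seq; apply: eq_bigr => l.
  by rewrite (mem_iota 0 14) => l14; rewrite co_bracket_bas.
have brZ c : [bas a, c *: bas k] = c *: [bas a, bas k] by rewrite linearZ.
rewrite {1}/eps brZ brE scaler_sumr -addrA; congr (_ + _).
  by apply: eq_bigr => l _; rewrite ev_eps_alt /eps !scalerA mulrC.
under [X in _ = X + _]eq_bigr do rewrite ev_eps_alt /eps scalerA.
under [X in _ = _ + X]eq_bigr do rewrite ev_eps_alt /eps scalerA.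
rewrite -!scaler_suml -[RHS]scalerDl /eps.
transitivity ((- (co [bas a, x] i * co y j - co [bas a, x] j * co y i) -
  (co x i * co [bas a, y] j - co x j * co [bas a, y] i)) *: bas k).
  by rewrite [RHS]scalerBl [in RHS]scaleNr.
congr (_ *: _).
rewrite !co_bracketl // !mulr_suml !mulr_sumr -[in RHS]big_split -!sumrB -!sumrN -big_split /=.
apply: eq_bigr => d _; rewrite (zKN K (sc a d i)) (zKN K (sc a d j)).
move: (zK K _) (zK K _) => s t; ring.
Qed.

Definition form14 (r : lform) :=
  all (fun t => if t.2 is [:: i; j; k] then [&& i < 14, j < 14 & k < 14]%N else false) r.

Lemma lie_action_form a r : (a < 14)%N -> form14 r ->
  lie_action r2 (bas a) (ev eps r) = ev eps (act_form a r).
Proof.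
move=> a14 /allP r14; rewrite /act_form ev_flatten big_map.
apply/funext => x; apply/funext => y; rewrite cochain2_sumE /lie_action /ev !cochain2_sumE.
rewrite linear_sum -!sumrB big_seq [RHS]big_seq; apply: eq_bigr => t tr.
have := r14 t tr; case: t {tr} => c [|i [|j [|k []]]] //= /and3P[i14 j14 k14].
rewrite linearZ -!scalerBr -/(ev eps (scale c (act_mono a i j k))) ev_scale.
by rewrite -lie_action_eps.
Qed.

(** The factor is the product of the values 24 and 8 of the Killing form on the
    pairs (e10, f10) and (e31, f31). *)
Lemma phi0_form : phi0 r2 = 192 *: ev eps (head [::] Ebasis).
Proof.
have k10 x : killing r2 (e10 K) x = 24 * co x 2.
  rewrite killingC -(killing_dualE r2_sqr x (t := (8, 2, Zpos 1)%N)) //= zK1.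
  by field.
have k31 x : killing r2 (e31 K) x = 8 * co x 6.
  rewrite killingC -(killing_dualE r2_sqr x (t := (12, 6, Zpos 3)%N)) //=.
  rewrite (_ : zK K (Zpos 3) = 3) //.
  by field.
rewrite /= /mono ev_cons ev_nil addr0 zK1 scale1r.
apply/funext => x; apply/funext => y; rewrite !fctE /phi0 /wedge_tens !k10 !k31 /eps.
by rewrite scalerA; congr (_ *: _); ring.
Qed.

Lemma parabolic_bas a : (a < 14)%N -> 0 <= idg a -> parabolic r2 (bas a).
Proof.
move=> a14 da; apply: co_filtration => // n n14 dn; rewrite co_bas //.
by case: eqP => // an; move: dn; rewrite -an ltNge da.
Qed.

(** Integer coordinates of the image of a column under [ad]. *)
Definition ad_column (a : nat) (c : seq Z) : seq Z :=
  [seq zsum (iota 0 14) (fun k => sc a k i * nth 0 c k)%R | i <- iota 0 14].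

Definition ad4_vanishes (a : nat) : bool :=
  all (fun j => iter 4 (ad_column a) [seq (i == j)%:R | i <- iota 0 14] == nseq 14 0%R)
    (iota 0 14).

Lemma ad_nilpotent a : (a < 14)%N -> ad4_vanishes a -> ad r2 (bas a) ^+ 4 = 0.
Proof.
move=> a14 /allP a4.
pose vec (c : seq Z) (x : g) := forall k, (k < 14)%N -> co x k = zK K (nth 0 c k).
have step c x : vec c x -> vec (ad_column a c) [bas a, x].
  move=> cx k k14; rewrite co_bracketl // (nth_map 0%N) ?size_iota // nth_iota // add0n.
  rewrite zK_zsum big_seq [RHS]big_seq; apply: eq_bigr => l.
  by rewrite (mem_iota 0 14) => l14; rewrite cx // zKM.
have steps n c x : vec c x -> vec (iter n (ad_column a) c) (iter n (bracket r2 (bas a)) x).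
  by move=> cx; elim: n => //= n; exact: step.
apply/matrixP => i j.
have -> : (ad r2 (bas a) ^+ 4) i j = co (iter 4 (bracket r2 (bas a)) (bas j)) i.
  have -> : iter 4 (bracket r2 (bas a)) (bas j) = ad r2 (bas a) ^+ 4 *m bas j.
    by rewrite !exprS expr0 mulr1 -!mulmxE -!mulmxA !ad_mul.
  by set A := _ ^+ 4; rewrite /co /bas !inord_val -colE [RHS]mxE.
have bj : vec [seq (i == j :> nat)%:R | i <- iota 0 14] (bas j).
  move=> k k14; rewrite co_bas // (nth_map 0%N) ?size_iota // nth_iota // add0n eq_sym.
  by case: eqP.
have jin : (j : nat) \in iota 0 14 by rewrite mem_iota ltn_ord.
rewrite (steps 4%N _ _ bj i) // (eqP (a4 _ jin)).
by rewrite nth_nseq ltn_ord [RHS]mxE.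
Qed.

(** Both e10 and e01 lie in p, and the fourth power of their [ad] vanishes; so the
    submodule is stable under them, and by induction along the list every line
    belongs to it. *)
Theorem Ebasis_in_module b : b \in Ebasis -> curvature_module r2 (ev eps b).
Proof.
move=> bE V [VP V0].
have [V00 VD _] := VP.
have act a r : a \in [:: 8; 9]%N -> form14 r -> V (ev eps r) -> V (ev eps (act_form a r)).
  move=> aE r14 Vr.
  have /and3P[a14 da a4] : [&& (a < 14)%N, 0 <= idg a & ad4_vanishes a].
    by move: aE; rewrite !inE => /orP[] /eqP ->; vm_compute.
  rewrite -lie_action_form //; apply: (P_submodule_lie r2_sqr) => //.
  - exact: parabolic_bas.
  - exact: ad_nilpotent.
  - exact: ev_bilinear.
have E14 r : r \in Ebasis -> form14 r by move: r; apply/allP.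
have chk : check_module by vm_compute.
have all_n n : (n < 24)%N -> V (ev eps (nth [::] Ebasis n)).
  elim/ltn_ind: n => -[|n] IH n24.
    have : V (phi0 r2) by exact: V0.
    rewrite phi0_form -nth0 => V1.
    have c0 : (192 : K) != 0 by rewrite pnatr_eq0.
    by rewrite -[ev _ _](scalerK c0); apply: subspaceZ.
  move: chk => /allP/(_ n.+1); rewrite mem_iota => /(_ n24) chk.
  apply: (in_span_sound V00 VD chk) (mem_head _ _) => p.
  move=> /flattenP[rs]; rewrite -map_take => /mapP[r /(nthP [::])[m]].
  rewrite size_takel; last exact: ltnW n24.
  move=> mn <- ->; rewrite nth_take // => pE.
  have rE : nth [::] Ebasis m \in Ebasis by apply: mem_nth; exact: leq_trans mn (ltnW n24).
  have Vr := IH m mn (ltn_trans mn n24).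
  by move: pE; rewrite !inE => /orP[] /eqP ->; apply: act => //; exact: E14.
by move: bE => /(nthP [::])[n n24 <-]; exact: all_n.
Qed.

End CurvatureModule.

(** * Cochains in the span of the basis *)

Section Conclusion.
Variables (K : numFieldType) (r2 : K).
Hypothesis r2_sqr : r2 ^+ 2 = 2.
Local Notation g := 'cV[K]_14.
Local Notation "[ x , y ]" := (bracket r2 x y) (at level 0, x, y at level 200).
Local Notation bas := (@bas K).
Local Notation eps := (@eps K).

Lemma ev_coef (T : eqType) (V : lmodType K) (e : T -> V) (vs : seq T) (r : form T) :
  uniq vs -> uniq (map snd r) -> {subset map snd r <= vs} ->
  ev e r = \sum_(x <- vs) zK K (coef x r) *: e x.
Proof.
move=> vsu; elim: r => [|[c y] r IH] /=.
  by move=> _ _; rewrite ev_nil big1 // => x _; rewrite zK0 scale0r.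
case/andP=> yr ru sub; rewrite ev_cons IH //; last first.
  by move=> x xr; apply: sub; rewrite inE xr orbT.
have yvs : y \in vs by apply: sub; rewrite mem_head.
have coef0 : forall r', y \notin map snd r' -> coef y r' = 0%R.
  by elim=> //= -[d z] r' IHr; rewrite inE => /norP[/negPf -> /IHr].
rewrite (bigD1_seq y) //= coef0 // zK0 scale0r add0r.
rewrite [RHS](bigD1_seq y) //= eqxx; congr (_ + _).
by apply: eq_bigr => x /negPf ->.
Qed.

Definition triple (v : nat * nat * nat) : seq nat := [:: v.1.1; v.1.2; v.2].

Lemma Ebasis_coef b : b \in Ebasis ->
  ev eps b = \sum_(v <- vars) zK K (coef (triple v) b) *: eps (triple v).
Proof.
move=> bE; rewrite -(big_map triple xpredT (fun x => zK K (coef x b) *: eps x)).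
have vu : uniq (map triple vars) by vm_compute.
have : all (fun b : lform => uniq (map snd b) && all (mem (map triple vars)) (map snd b)) Ebasis.
  by vm_compute.
by move=> /allP/(_ b bE)/andP[bu /allP bs]; exact: ev_coef.
Qed.

Lemma ev_expand_coef (v : seq nat -> K^o) x :
  ev v (expand x) = \sum_(b <- Ebasis) zK K (coef x b) * v (head (Z0, [::]) b).2.
Proof.
rewrite /ev /expand big_map big_filter [LHS]big_mkcond; apply: eq_bigr => b _.
by case: eqP => //= ->; rewrite zK0 mul0r.
Qed.

Section Cochain.
Variable phi : cochain2 K.
Hypothesis phi_normal : normal r2 phi.

Lemma vdeg_vars v : v \in vars -> Z.lt (vdeg v.1.1 v.1.2 v.2) (Zpos 10).
Proof.
by move=> vin; apply/Z.ltb_spec0; move: v vin; apply/allP; vm_compute.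
Qed.

Lemma vars14 v : v \in vars -> [/\ v.1.1 \in neg, v.1.2 \in neg, (v.1.1 < v.1.2)%N & (v.2 < 14)%N].
Proof.
move=> vin; apply/and4P; move: v vin; apply/allP; vm_compute; by [].
Qed.

(** By regularity there is no component of degree less than 1; nor does [Ebasis]
    contain any. *)
Lemma in_E_below1 : in_E_below (Zpos 1) phi.
Proof.
have [hphi pphi _] := phi_normal.
move=> i j k ijk deg; have [/neg14 i14 /neg14 j14 _ /= k14] := vars14 ijk.
rewrite pphi //; last by apply/negbTE/negP => /Z.ltb_spec0; lia.
have : all (fun v => Z.ltb Z0 (vdeg v.1.1 v.1.2 v.2) || nilp (expand (triple v))) vars.
  by vm_compute.
move=> /allP/(_ _ ijk)/orP[/Z.ltb_spec0 /=|/nilP]; first by lia.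
by rewrite /triple /= => ->; rewrite ev_nil.
Qed.

Hypothesis phi_E : in_E_below (Zpos 10) phi.

(** The lines of [Ebasis] are in reduced echelon form, so the coefficients of an
    element of the span are its pivot components. *)
Lemma E_combination :
  phi = \sum_(b <- Ebasis) val2 phi (head (Z0, [::]) b).2 *: ev eps b.
Proof.
have [hphi pphi _] := phi_normal.
transitivity (\sum_(v <- vars) ev (val2 phi) (expand (triple v)) *: eps (triple v)).
  transitivity (\sum_(v <- vars) co (phi (bas v.1.1) (bas v.1.2)) v.2 *: eps (triple v)).
    apply/funext => x; apply/funext => y; rewrite cochain2_sumE hphi.
    rewrite /vars big_allpairs; apply: eq_bigr => ij _.
    rewrite {1}[phi (bas ij.1) (bas ij.2)]basE scaler_sumr; apply: eq_bigr => k _.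
    by rewrite -[(_ *: eps _) x y]/(_ *: eps _ x y) /eps /= !scalerA mulrC.
  rewrite big_seq [RHS]big_seq; apply: eq_bigr => v vin; congr (_ *: _).
  by apply: phi_E; [case: v vin => -[]|exact: vdeg_vars].
under eq_bigr do rewrite ev_expand_coef scaler_suml.
rewrite exchange_big /= big_seq [RHS]big_seq; apply: eq_bigr => b bE.
rewrite (Ebasis_coef bE) scaler_sumr; apply: eq_bigr => v _.
by rewrite scalerA mulrC.
Qed.

Theorem in_curvature_module : curvature_module r2 phi.
Proof.
move=> V VP; have [[V0 VD _] _] := VP.
rewrite E_combination big_seq; apply: subspace_sum => // b bE.
by apply: subspaceZ => //; exact: (Ebasis_in_module r2_sqr bE VP).
Qed.

Lemma neg_idg n : (n < 14)%N -> idg n < 0 -> n \in neg.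
Proof.
move=> n14; have : all (fun n => (idg n < 0) ==> (n \in neg)) (iota 0 14) by [].
by move=> /allP/(_ n); rewrite mem_iota => /(_ n14)/implyP; apply.
Qed.

Theorem torsion_free x y : parabolic r2 (phi x y).
Proof.
have [hphi pphi _] := phi_normal.
apply: co_filtration => // n n14 /(neg_idg n14) nneg.
rewrite hphi co_sum big_seq big1 // => ij ijin; rewrite coZ.
have kin : (ij, 0%N) \in vars by rewrite allpairs_f.
have [/= /neg14 i14 /neg14 j14 _ _] := vars14 kin.
have nin : (ij, n) \in vars by apply: allpairs_f => //; rewrite mem_iota.
by rewrite (torsion_vanish hphi pphi phi_E) ?mulr0 //; exact: (vdeg_vars nin).
Qed.

Theorem vanish_on_filtration2 x y :
  filtration r2 (-2) x -> filtration r2 (-2) y -> phi x y = 0.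
Proof.
have [hphi pphi _] := phi_normal => x2 y2.
have c67 z n : filtration r2 (-2) z -> n \in [:: 6; 7]%N -> co z n = 0.
  by move=> z2; rewrite !inE => /orP[] /eqP ->; apply: (filtration_co r2_sqr z2).
rewrite hphi big_seq big1 // => -[i j] ij /=.
have [i67|i67] := boolP (i \in [:: 6; 7]%N).
  by rewrite (c67 x) // (c67 y i) // mul0r mulr0 subrr scale0r.
have [j67|j67] := boolP (j \in [:: 6; 7]%N).
  by rewrite (c67 x j) // (c67 y j) // mul0r mulr0 subrr scale0r.
suff -> : phi (bas i) (bas j) = 0 by rewrite scaler0.
apply: co_eq => k k14; rewrite co0.
have kin : (i, j, k) \in vars by apply: allpairs_f => //; rewrite mem_iota.
rewrite (phi_E kin (vdeg_vars kin)).
have : all (fun v => [|| v.1.1 \in [:: 6; 7]%N, v.1.2 \in [:: 6; 7]%N | nilp (expand (triple v))]) vars.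
  by vm_compute.
move=> /allP/(_ _ kin); rewrite /= (negPf i67) (negPf j67) /= => /nilP.
by rewrite /triple /= => ->; rewrite ev_nil.
Qed.

End Cochain.
End Conclusion.

(** * A mean value inequality over the real and the complex numbers *)

Local Open Scope classical_set_scope.
Local Open Scope ring_scope.

(** The only property of the ground field on which the differential calculus
    below depends.  In the complex numbers the condition 0 <= t <= 1 restricts t
    to the real segment.  The factor 2 makes room for a separate treatment of
    real and imaginary parts. *)
Definition mean_value_inequality (K : numFieldType) :=
  forall (f df : K -> K) (M : K),
    (forall t : K, 0 <= t <= 1 -> is_derive t (1 : K) f (df t)) ->
    (forall t : K, 0 <= t <= 1 -> `|df t| <= M) -> `|f 1 - f 0| <= 2 * M.

Lemma mean_value_inequality_real (R : realType) : mean_value_inequality R.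
Proof.
move=> f df M fdf dfM.
have M0 : 0 <= M by apply: le_trans (dfM 0 _); rewrite ?lexx ?ler01.
have fcont : {within `[0, 1], continuous f}.
  apply: derivable_within_continuous => t; rewrite in_itv /= => t01.
  by have [] := fdf _ t01.
have [t|t + ->] := @MVT_segment R f df 0 1 ler01 _ fcont.
  by rewrite in_itv /= => /andP[/ltW t0 /ltW t1]; apply: fdf; rewrite t0 t1.
rewrite in_itv /= subr0 mulr1 => /dfM /le_trans; apply.
by rewrite -[leLHS]mul1r ler_wpM2r// ler1n.
Qed.

Section RealPart.
Variable R : realType.
Local Notation C := (R[i] : numFieldType).

(** A real functional that does not increase the norm, such as the real or the
    imaginary part, turns a complex derivative at a point of the real axis into
    a real one. *)
Lemma is_derive_real_part (L : R[i] -> R) :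
  (forall x y, L (x - y) = L x - L y) -> (forall (a : R) x, L (a%:C%C * x) = a * L x) ->
  (forall x, (`|L x|)%:C%C <= `|x|) ->
  forall (f : C -> C) (t : R) (d : C), is_derive (t%:C%C : C) (1 : C) f d ->
  is_derive t 1 (fun s => L (f s%:C%C)) (L d).
Proof.
move=> LB LZ Ln f t d [fdrv fd].
suff cvgL : (fun h => h^-1 *: (L (f (h *: 1 + t)%:C%C) - L (f t%:C%C))) @ 0^' --> L d.
  by split; [apply/cvg_ex; exists (L d)|apply: cvg_lim].
apply/cvgrPdist_lt => e e0.
have : (fun h : C => h^-1 *: (f (h *: 1 + t%:C%C) - f t%:C%C)) @ 0^' --> d.
  by rewrite -fd; exact: fdrv.
move=> /cvgrPdist_lt/(_ e%:C%C); rewrite ltcR => /(_ e0)[r /= r0 rP].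
have [r' r'0 rE] : exists2 r', 0 < r' & r = r'%:C%C.
  case: r r0 {rP} => a b; rewrite ltcE /= => /andP[/eqP -> a0]; by exists a.
exists r' => //= h; rewrite /ball_ /= sub0r normrN => hr h0.
have hE : (h%:C%C)^-1 = (h^-1)%:C%C :> R[i] by rewrite fmorphV.
have /= := rP (h%:C%C); rewrite /ball_ /= sub0r normrN normc_def /= expr0n /= addr0 sqrtr_sqr.
rewrite rE ltcR => /(_ hr); rewrite (inj_eq (fmorph_inj _)) => /(_ h0).
rewrite /GRing.scale /= !mulr1 hE => lt_e.
rewrite -ltcR; apply: le_lt_trans lt_e.
by rewrite -LB -LZ -LB rmorphD.
Qed.

Lemma mean_value_inequality_complex : mean_value_inequality C.
Proof.
move=> f df M fdf dfM.
have M0 : 0 <= M by apply: le_trans (dfM 0 _); rewrite ?lexx ?ler01.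
have [m mE] : exists m, M = m%:C%C.
  by exists (complex.Re M); rewrite RRe_real// ger0_real.
have part (L : R[i] -> R) :
    (forall x y, L (x - y) = L x - L y) ->
    (forall (a : R) x, L (a%:C%C * x) = a * L x) ->
    (forall x, (`|L x|)%:C%C <= `|x|) -> `|L (f 1 - f 0)| <= m.
  move=> LB LZ Ln.
  (* The complex order compares real parts only between numbers with equal imaginary
     parts, so the segment is the image of the real one. *)
  have unit_segment (s : R) : 0 <= s <= 1 -> (0 : R[i]) <= s%:C%C <= 1.
    by rewrite !lecE /= eqxx.
  have fcont : {within `[0, 1], continuous (fun s => L (f s%:C%C))}.
    apply: derivable_within_continuous => t; rewrite in_itv /= => /unit_segment t01.
    by have [] := is_derive_real_part LB LZ Ln (fdf _ t01).
  have [t|t + tE] := @MVT_segment R _ (fun s => L (df s%:C%C)) 0 1 ler01 _ fcont.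
    rewrite in_itv /= => /andP[/ltW t0 /ltW t1].
    apply: (is_derive_real_part LB LZ Ln (fdf _ _)).
    by apply: unit_segment; rewrite t0 t1.
  rewrite LB (tE : _ = _) in_itv /= subr0 mulr1 => /unit_segment/dfM.
  by rewrite mE => /(le_trans (Ln _)); rewrite lecR.
have hRe : `|complex.Re (f 1 - f 0)| <= m.
  apply: part => [[? ?] [? ?]|a [? ?]|x] //=; first by rewrite mul0r subr0.
  exact: normc_ge_Re.
have hIm : `|complex.Im (f 1 - f 0)| <= m.
  apply: part => [[? ?] [? ?]|a [? ?]|x] //=; first by rewrite mul0r addr0.
  rewrite normc_def lecR -sqrtr_sqr ler_wsqrtr//.
  by rewrite lerDr sqr_ge0.
rewrite mE -[2]/(2%:R) -(rmorph_nat (real_complex R)) -rmorphM /=.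
rewrite [f 1 - f 0]complexE (le_trans (ler_normD _ _))// normrM.
have -> : `|'i%C| = 1 :> R[i] by rewrite normc_def /= expr0n /= expr1n add0r sqrtr1.
rewrite mul1r !normc_def /= !expr0n /= !addr0 !sqrtr_sqr -rmorphD lecR.
by rewrite mulr_natl mulr2n lerD.
Qed.

End RealPart.

(** * Symmetry of second derivatives *)

Section Schwarz.
Variables (K : numFieldType).
Hypothesis mvi : mean_value_inequality K.

(** The inequality applied to [f] minus an affine function. *)
Lemma mean_value_affine (f df : K -> K) (A M : K) :
  (forall t : K, 0 <= t <= 1 -> is_derive t (1 : K) f (df t)) ->
  (forall t : K, 0 <= t <= 1 -> `|df t - A| <= M) -> `|f 1 - f 0 - A| <= 2 * M.
Proof.
move=> fdf dfM.
have := @mvi (fun t => f t - A * t) (fun t => df t - A) M _ dfM.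
rewrite mulr1 mulr0 subr0 [in X in X -> _]addrAC; apply => t t01.
have := fdf t t01 => ?.
apply: is_derive_eq.
by rewrite /GRing.scale /= mulr1.
Qed.

Lemma is_derive_rescale (g : K -> K) (t s : K) : derivable g (s * t) 1 ->
  is_derive s (1 : K) (fun s : K => g (s * t)) (t * 'D_1 g (s * t)).
Proof.
move=> /derivable1_diffP gd.
have cd : is_diff s (fun s : K => s * t : K) (fun s : K => s * t : K).
  exact: (@is_diff_scalel K K s t).
have gcd := @is_diff_comp _ _ _ _ _ _ g _ s cd (differentiableP gd).
apply: DeriveDef; first exact/derivable1_diffP/ex_diff.
apply: etrans (deriveE _ ex_diff) _.
apply: etrans (congr1 (@^~ 1) (@diff_val _ _ _ _ _ _ _ gcd)) _.
apply: etrans (congr1 (@^~ (1 * t)) (diff1E gd)) _.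
by rewrite mul1r derive1E.
Qed.

Lemma is_derive_line (V : normedModType K) (f : V -> K) (x v : V) (t s : K) :
  derivable f (x + (s * t) *: v) v ->
  is_derive s (1 : K) (fun s : K => f (x + (s * t) *: v)) (t * 'D_v f (x + (s * t) *: v)).
Proof.
move=> fd.
pose g (r : K) := f (x + r *: v).
have gE : (fun h : K => h^-1 *: ((g \o shift (s * t)) (h *: (1 : K)) - g (s * t))) =
  (fun h => h^-1 *: ((f \o shift (x + (s * t) *: v)) (h *: v) - f (x + (s * t) *: v))).
  apply/funext => h /=; rewrite /g [h *: 1]mulr1 scalerDl; congr (_ *: (f _ - _)).
  by rewrite addrCA.
have gd : derivable g (s * t) 1 by rewrite /derivable gE; exact: fd.
have <- : 'D_1 g (s * t) = 'D_v f (x + (s * t) *: v) by rewrite /derive gE.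
exact: is_derive_rescale gd.
Qed.

(** Two applications of the mean value inequality, along [v] and then along [w],
    compare the second difference over a parallelogram with t^2 A when the mixed
    derivative stays close to A on it. *)
Lemma second_difference (V : normedModType K) (f : V -> K) (x v w : V) (t A e : K) :
  0 <= t ->
  (forall a b : K, 0 <= a <= 1 -> 0 <= b <= 1 ->
    let y := x + (a * t) *: v + (b * t) *: w in
    [/\ derivable f y v, derivable ('D_v f) y w & `|'D_w ('D_v f) y - A| <= e]) ->
  `|f (x + t *: v + t *: w) - f (x + t *: v) - (f (x + t *: w) - f x) - t ^+ 2 * A|
    <= 4 * t ^+ 2 * e.
Proof.
move=> t0 H; pose P (a b : K) := x + (a * t) *: v + (b * t) *: w.
have i0 : 0 <= (0 : K) <= 1 by apply/andP; split.
have i1 : 0 <= (1 : K) <= 1 by apply/andP; split.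
have PC a b : P a b = x + (b * t) *: w + (a * t) *: v by rewrite /P addrAC.
have inner a : 0 <= a <= 1 ->
    `|'D_v f (P a 1) - 'D_v f (P a 0) - t * A| <= 2 * (t * e).
  move=> a01; apply: (@mean_value_affine (fun b => 'D_v f (P a b))
    (fun b => t * 'D_w ('D_v f) (P a b))).
    by move=> b b01; apply: is_derive_line; have [] := H a b a01 b01.
  move=> b b01; rewrite -mulrBr normrM (ger0_norm t0) ler_wpM2l //.
  by have [] := H a b a01 b01.
have P11 : P 1 1 = x + t *: v + t *: w by rewrite /P !mul1r.
have P10 : P 1 0 = x + t *: v by rewrite /P mul1r mul0r scale0r addr0.
have P01 : P 0 1 = x + t *: w by rewrite /P mul1r mul0r scale0r addr0.
have P00 : P 0 0 = x by rewrite /P mul0r !scale0r !addr0.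
have -> : 4 * t ^+ 2 * e = 2 * (t * (2 * (t * e))) by ring.
rewrite -P11 -P10 -P01 -[in f x]P00.
apply: (@mean_value_affine (fun a => f (P a 1) - f (P a 0))
  (fun a => t * 'D_v f (P a 1) - t * 'D_v f (P a 0))) => a a01; last first.
  have -> : t * 'D_v f (P a 1) - t * 'D_v f (P a 0) - t ^+ 2 * A =
      t * ('D_v f (P a 1) - 'D_v f (P a 0) - t * A) by ring.
  by rewrite normrM (ger0_norm t0) ler_wpM2l // inner.
have line b : 0 <= b <= 1 ->
    is_derive a (1 : K) (fun a => f (P a b)) (t * 'D_v f (P a b)).
  move=> b01; have /= [fd _ _] := H a b a01 b01; move: fd.
  rewrite addrAC => /is_derive_line; rewrite -PC.
  by congr (is_derive _ _ _ _); apply/funext => a'; rewrite PC.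
by apply: is_deriveB; apply: line.
Qed.

Lemma small_parallelogram (V : normedModType K) (S : set V) (x v w : V) :
  nbhs x S -> exists2 t : K, 0 < t & forall a b : K,
    0 <= a <= 1 -> 0 <= b <= 1 -> S (x + (a * t) *: v + (b * t) *: w).
Proof.
move=> /nbhs_ballP[r /= r0 rS].
have n0 : 0 < `|v| + `|w| + 1 by rewrite ltr_wpDl // addr_ge0.
exists (r / (`|v| + `|w| + 1)); first by rewrite divr_gt0.
set t := r / _; have t0 : 0 < t by rewrite divr_gt0.
have tn (c : K) (z : V) : 0 <= c <= 1 -> `|(c * t) *: z| <= t * `|z|.
  move=> /andP[c0 c1]; rewrite normrZ (ger0_norm (mulr_ge0 c0 (ltW t0))).
  exact: ler_wpM2r (ler_piMl (ltW t0) c1).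
move=> a b a01 b01; apply: rS.
rewrite -ball_normE /ball_ /= -addrA opprD addNKr normrN.
apply: (@le_lt_trans _ _ (t * (`|v| + `|w|))).
  by rewrite (le_trans (ler_normD _ _)) // mulrDr lerD // tn.
by rewrite /t mulrAC ltr_pdivrMr // ltr_pM2l // ltrDl.
Qed.

Lemma second_difference_squeeze (t e A B d1 d2 : K) : 0 < t ->
  `|d1 - t ^+ 2 * A| <= 4 * t ^+ 2 * (e / 8) ->
  `|d2 - t ^+ 2 * B| <= 4 * t ^+ 2 * (e / 8) -> d1 = d2 -> `|A - B| <= e.
Proof.
move=> t0 H1 H2 dE; have t2 : 0 < t ^+ 2 by rewrite exprn_gt0.
rewrite -(ler_pM2l t2) -{1}(gtr0_norm t2) -normrM.
have -> : t ^+ 2 * e = 4 * t ^+ 2 * (e / 8) + 4 * t ^+ 2 * (e / 8) by field.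
have -> : t ^+ 2 * (A - B) = (d2 - t ^+ 2 * B) - (d1 - t ^+ 2 * A).
  by rewrite dE; ring.
exact: le_trans (ler_normB _ _) (lerD H2 H1).
Qed.

(** The second difference over a small parallelogram is symmetric in [v] and [w],
    and by continuity it is close to t^2 times either of the two mixed
    derivatives. *)
Lemma derive_commute (V : normedModType K) (f : V -> K) (x v w : V) :
  (\near x, [/\ derivable f x v, derivable f x w, derivable ('D_v f) x w
             & derivable ('D_w f) x v]) ->
  {for x, continuous ('D_w ('D_v f))} -> {for x, continuous ('D_v ('D_w f))} ->
  'D_w ('D_v f) x = 'D_v ('D_w f) x.
Proof.
move=> fd cwv cvw; apply/eqP; rewrite -subr_eq0 -normr_le0.
apply/ler_addgt0Pl => e e0; rewrite addr0.
(* Two errors of 4 t^2 (e / 8) add up to t^2 e. *)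
have e8 : 0 < e / 8 by rewrite divr_gt0.
have /cvgrPdistC_le/(_ _ e8) Awv := cwv; have /cvgrPdistC_le/(_ _ e8) Avw := cvw.
have [t t0 tP] := small_parallelogram v w (filterI fd (filterI Awv Avw)).
have H1 := @second_difference _ f x v w t ('D_w ('D_v f) x) (e / 8) (ltW t0).
have H2 := @second_difference _ f x w v t ('D_v ('D_w f) x) (e / 8) (ltW t0).
set A := 'D_w ('D_v f) x in H1 *; set B := 'D_v ('D_w f) x in H2 *.
have {}H1 : `|f (x + t *: v + t *: w) - f (x + t *: v) - (f (x + t *: w) - f x) - t ^+ 2 * A|
    <= 4 * t ^+ 2 * (e / 8).
  by apply: H1 => a b a01 b01 y; have := tP a b a01 b01; rewrite -/y => -[[? _ ? _] [? _]].
have {}H2 : `|f (x + t *: w + t *: v) - f (x + t *: w) - (f (x + t *: v) - f x) - t ^+ 2 * B|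
    <= 4 * t ^+ 2 * (e / 8).
  apply: H2 => a b a01 b01 y; have := tP b a b01 a01.
  by rewrite addrAC -/y => -[[_ ? _ ?] [_ ?]].
by apply: second_difference_squeeze t0 H1 H2 _; rewrite [x + t *: w + t *: v]addrAC; ring.
Qed.

End Schwarz.

(** * Differentiability of maps with continuous partial derivatives *)

Section C1.
Variables (K : numFieldType).
Hypothesis mvi : mean_value_inequality K.

Lemma entry_norm_le m n (x : 'M[K]_(m.+1, n.+1)) i j : `|x i j| <= `|x|.
Proof.
rewrite [leRHS]/Num.norm /= mx_normE -[leLHS]nngE num_le.
exact: (@le_bigmax _ _ _ _ (fun ij => `|x ij.1 ij.2|%:nng) (i, j)).
Qed.

Lemma differentiable_of_bound (V W : normedModType K) (f : V -> W)
    (d : {linear V -> W}) (x : V) : continuous d ->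
  (forall e : K, 0 < e -> \forall h \near (0 : V), `|f (x + h) - f x - d h| <= e * `|h|) ->
  differentiable f x.
Proof.
move=> dc H.
have dE : f \o shift x = cst (f x) + d +o_ 0 id.
  apply/eqaddoP => _/posnumP[e]; near=> h.
  rewrite (_ : _ h = f (x + h) - f x - d h); first by near: h; exact: H.
  by rewrite !fctE /= [h + x]addrC opprD addrA.
have fdE := diff_unique dc dE.
by apply/diff_locallyP; rewrite fdE.
Unshelve. all: by end_near. Qed.

(** Join [x] to [x + h] by moving one coordinate at a time; the mean value
    inequality compares the increment along each edge with the corresponding
    partial derivative at [x]. *)
Lemma differentiable_of_C1 n (f : 'cV[K]_n.+1 -> K^o) (x : 'cV[K]_n.+1) :
  (\near x, forall v, derivable f x v) ->
  (forall v, {for x, continuous ('D_v f)}) -> differentiable f x.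
Proof.
move=> fd fc; pose e i : 'cV[K]_n.+1 := delta_mx i 0.
pose a i := 'D_(e i) f x.
pose d (h : 'cV[K]_n.+1) : K^o := \sum_i h i 0 * a i.
have dlin : linear d.
  move=> c u w; rewrite /d scaler_sumr -big_split /=; apply: eq_bigr => i _.
  by rewrite !mxE mulrDl -mulrA.
pose dl : {linear 'cV[K]_n.+1 -> K^o} := HB.pack d (GRing.isLinear.Build _ _ _ _ _ dlin).
have dc : continuous d.
  move=> h; apply: differentiable_continuous.
  have -> : d = \sum_i (fun h : 'cV[K]_n.+1 => h i 0 * a i : K).
    by apply/funext => h'; rewrite fct_sumE.
  apply: differentiable_sum => i; apply: differentiableM => //.
  exact: differentiable_coord.
apply: (@differentiable_of_bound _ _ f dl) => // eps eps0.
(* The vertices of the path from 0 to [h] that moves one coordinate at a time. *)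
pose P (h : 'cV[K]_n.+1) (k : nat) := \sum_(i < n.+1 | (i < k)%N) h i 0 *: e i.
(* Each of the n + 1 edges contributes at most 2 e' |h|. *)
pose e' := eps / (2 * n.+1%:R).
have e'0 : 0 < e' by rewrite divr_gt0 // mulr_gt0 // ltr0n.
have : \near x, (forall v, derivable f x v) /\
    forall i : 'I_n.+1, `|'D_(e i) f x - a i| <= e'.
  apply: filterI => //.
  apply: (@filter_forall _ _ _ (nbhs x) _) => i.
  by have /cvgrPdistC_le/(_ _ e'0) := fc (e i).
move=> /nbhs_ballP[r /= r0 rP].
near=> h => /=.
have hr : `|h| < r.
  near: h; apply/nbhs_ballP; exists r => // h.
  by rewrite -ball_normE /ball_ /= sub0r normrN.
suff : `|f (x + h) - f x - d h| <= \sum_(k < n.+1) 2 * (`|h| * e').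
  rewrite sumr_const card_ord -mulr_natr /= => le_h.
  apply: le_trans le_h _; rewrite /e' le_eqVlt; apply/orP; left; apply/eqP.
  have n0 : n.+1%:R != 0 :> K by rewrite pnatr_eq0.
  by field.
have hn i : `|h i 0| <= `|h| by exact: entry_norm_le.
have PE (k : 'I_n.+1) : P h k.+1 = P h k + h k 0 *: e k.
  rewrite /P (bigD1 k) //= addrC; congr (_ + _).
  by apply: eq_bigl => i; rewrite ltnS ltn_neqAle andbC.
have Pe k (i : 'I_n.+1) : P h k i 0 = if (i < k)%N then h i 0 else 0.
  rewrite /P summxE; case: ifP => ik.
    rewrite (bigD1 i) //= !mxE !eqxx mulr1 big1 ?addr0 // => j.
    by case/andP=> _ /negPf ji; rewrite !mxE eq_sym ji mulr0.
  rewrite big1 // => j jk; rewrite !mxE; case: eqP => [ij|]; last by rewrite mulr0.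
  by rewrite ij jk in ik.
have P0 : P h 0 = 0 by rewrite /P big_pred0.
have Pn : P h n.+1 = h.
  by apply/colP => i; rewrite Pe ltn_ord.
have -> : f (x + h) - f x - d h =
    \sum_(k < n.+1) (f (x + P h k.+1) - f (x + P h k) - h k 0 * a k).
  rewrite sumrB; congr (_ - _).
  rewrite -(big_mkord xpredT (fun k => f (x + P h k.+1) - f (x + P h k))).
  by rewrite telescope_sumr // Pn P0 addr0.
apply: le_trans (ler_norm_sum _ _ _) _; apply: ler_sum => k _.
have inball s : 0 <= s <= 1 -> ball x r (x + P h k + (s * h k 0) *: e k).
  move=> /andP[s0 s1]; split => // i j; rewrite -ball_normE /ball_ /= ord1.
  rewrite !mxE Pe eqxx andbT -addrA opprD addNKr normrN.
  case: (ltngtP i k) => ik.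
  - rewrite (_ : (i == k) = false) ?mulr0 ?addr0 ?(le_lt_trans (hn _)) //.
    by apply/eqP => ikE; rewrite ikE ltnn in ik.
  - rewrite (_ : (i == k) = false) ?mulr0 ?addr0 ?normr0 //.
    by apply/eqP => ikE; rewrite ikE ltnn in ik.
  - rewrite (_ : i = k); last exact: val_inj.
    rewrite eqxx mulr1 add0r normrM (ger0_norm s0) (le_lt_trans _ hr) //.
    by rewrite (le_trans _ (hn k)) // ler_piMl.
pose F (s : K) := f (x + P h k + (s * h k 0) *: e k).
have -> : f (x + P h k.+1) = F 1 by rewrite /F PE mul1r addrA.
have -> : f (x + P h k) = F 0 by rewrite /F mul0r scale0r addr0.
apply: (@mean_value_affine _ mvi F
  (fun s => h k 0 * 'D_(e k) f (x + P h k + (s * h k 0) *: e k))) => s s01.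
  by apply: is_derive_line; have [] := rP _ (inball s s01).
have [_ /(_ k) le_e] := rP _ (inball s s01).
by rewrite -mulrBr normrM ler_pM.
Unshelve. all: by end_near. Qed.
End C1.

(** * Calculus of matrix-valued maps *)

Section Matrices.
Variables (K : numFieldType).

Lemma cvg_mx (T : Type) (F : set_system T) (FF : Filter F) m n
    (g : T -> 'M[K]_(m.+1, n.+1)) (l : 'M[K]_(m.+1, n.+1)) :
  (forall i j, (fun t => g t i j : K^o) @ F --> (l i j : K^o)) -> g @ F --> l.
Proof.
move=> gl; apply/cvg_ballP => e e0.
have : \forall t \near F, forall i j, ball (l i j : K^o) e (g t i j).
  apply: filter_forall => i; apply: filter_forall => j.
  exact: (cvg_ball (gl i j)).
by apply: filterS => t; split.
Qed.

Lemma is_derive_mx (V : normedModType K) m n (M : V -> 'M[K]_(m.+1, n.+1))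
    (D : 'M[K]_(m.+1, n.+1)) (x v : V) :
  is_derive x v M D <-> forall i j, is_derive x v (fun y => M y i j : K^o) (D i j).
Proof.
pose q h := h^-1 *: (M (h *: v + x) - M x).
have qE i j h : q h i j = h^-1 * (M (h *: v + x) i j - M x i j) by rewrite !mxE.
split=> [[Md <-] i j|Mij].
  have Mc : (fun h => q h i j : K^o) @ 0^' --> ('D_v M x i j : K^o).
    have Mq : q @ 0^' --> 'D_v M x by exact: Md.
  exact: (cvg_comp _ _ Mq (@coord_continuous K m.+1 n.+1 i j ('D_v M x))).
  rewrite (_ : (fun h => q h i j) = fun h => h^-1 * (M (h *: v + x) i j - M x i j)) in Mc.
    by split; [apply/cvg_ex; exists ('D_v M x i j)|exact: cvg_lim].
  by apply/funext => h; rewrite qE.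
have Mc : q @ 0^' --> D.
  apply: cvg_mx => i j; have [Md <-] := Mij i j.
  rewrite (_ : (fun h => q h i j) = fun h => h^-1 * (M (h *: v + x) i j - M x i j)).
    exact: Md.
  by apply/funext => h; rewrite qE.
by split; [apply/cvg_ex; exists D|exact: cvg_lim].
Qed.

End Matrices.

Section Regularity.
Variables (K : numFieldType).

Lemma near_open (V : normedModType K) (U : set V) (P : V -> Prop) x :
  open U -> U x -> (forall y, U y -> P y) -> \near x, P x.
Proof. by move=> Uo Ux UP; apply: filterS UP _; apply: open_nbhs_nbhs. Qed.

Lemma Ck_congr k (V W : normedModType K) (U : set V) (f g : V -> W) :
  open U -> (forall x, U x -> f x = g x) -> Ck k U f -> Ck k U g.
Proof.
move=> Uo; elim: k f g => [|k IH] f g fg /= [fc fk].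
  split=> // x Ux; rewrite /prop_for /continuous_at -(fg x Ux).
  by apply: cvg_trans (fc x Ux); apply: near_eq_cvg; apply: near_open fg.
split=> [x Ux|v].
  rewrite /prop_for /continuous_at -(fg x Ux).
  by apply: cvg_trans (fc x Ux); apply: near_eq_cvg; apply: near_open fg.
have [fd fD] := fk v; split=> [x Ux|].
  by apply: near_eq_derivable (fd x Ux); apply: near_open fg.
apply: IH fD => x Ux; apply: near_eq_derive; exact: near_open fg.
Qed.

Lemma CkW k l (V W : normedModType K) (U : set V) (f : V -> W) :
  (k <= l)%N -> Ck l U f -> Ck k U f.
Proof.
elim: k l f => [|k IH] [|l] f //= kl [fc fl]; split=> // v.
by have [fd fD] := fl v; split=> //; apply: IH fD.
Qed.

Lemma Ck_sub k (V W : normedModType K) (U U' : set V) (f : V -> W) :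
  U' `<=` U -> Ck k U f -> Ck k U' f.
Proof.
move=> sU; elim: k f => [|k IH] f /= [fc fk]; first by split=> // x /sU; exact: fc.
split=> [x /sU|v]; first exact: fc.
by have [fd fD] := fk v; split=> [x /sU|]; [exact: fd|exact: IH].
Qed.

(** On an open set the local extension in the definition of smoothness is the map
    itself. *)
Lemma smooth_on_Ck k (V W : normedModType K) (S : set V) (f : V -> W) x :
  open S -> S x -> smooth_on S f ->
  exists U : set V, [/\ open U, U x, U `<=` S & Ck k U f].
Proof.
move=> So Sx /(_ x Sx)[U [g [Uo Ux gk fg]]].
have USo : open (U `&` S) by exact: openI.
exists (U `&` S); split; [by []|by split|exact: subIsetr|].
apply: (@Ck_congr k _ _ _ g) => // [y [Uy Sy]|].
  by rewrite fg.
by apply: Ck_sub (gk k); exact: subIsetl.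
Qed.

Lemma Ck_entry k (V : normedModType K) m n (U : set V)
    (M : V -> 'M[K]_(m.+1, n.+1)) i j :
  open U -> Ck k U M -> Ck k U (fun y => M y i j : K^o).
Proof.
move=> Uo; have cE (f : V -> 'M[K]_(m.+1, n.+1)) x :
    {for x, continuous f} -> {for x, continuous (fun y => f y i j : K^o)}.
  by move=> fc; exact: (cvg_comp _ _ fc (@coord_continuous K m.+1 n.+1 i j (f x))).
elim: k M => [|k IH] M /= [Mc Mk]; first by split=> // x Ux; exact/cE/Mc.
split=> [x Ux|v]; first exact/cE/Mc.
have [Md MD] := Mk v.
have ed x : U x -> is_derive x v (fun y => M y i j : K^o) ('D_v M x i j).
  by move=> Ux; move/is_derive_mx: (derivableP (Md x Ux)); apply.
split=> [x /ed[]//|].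
by apply: (@Ck_congr k _ _ _ (fun y => 'D_v M y i j : K^o)) (IH _ MD) => // x /ed[_ ->].
Qed.

Lemma is_derive_chain (V V' W : normedModType K) (g : V -> V') (f : V' -> W) x v :
  derivable g x v -> differentiable f (g x) ->
  is_derive x v (f \o g) ('D_('D_v g x) f (g x)).
Proof.
move=> /derivable1P gd fd.
pose c (h : K) := g (h *: v + x).
have c0 : c 0 = g x by rewrite /c scale0r add0r.
have cd : differentiable c 0 := (@derivable1_diffP _ _ c 0).1 gd.
rewrite -c0 in fd *.
have fcd : differentiable (f \o c) 0 by exact: differentiable_comp.
have fgd : derivable (f \o g) x v.
  apply: (@derivable1P _ _ _ (f \o g) x v).2.
  exact: ((@derivable1_diffP _ _ (f \o c) 0).2 fcd).
split=> //.
have line (W' : normedModType K) (h : V -> W') :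
    'D_v h x = 'D_1 (fun s : K => h (s *: v + x)) 0.
  rewrite /derive; set q1 := fun s => s^-1 *: _; set q2 := fun s => s^-1 *: _.
  suff -> : q1 = q2 by []; apply/funext => s; rewrite /q1 /q2 /=.
  by rewrite addr0 scale0r add0r [_%:A]mulr1.
rewrite !line (deriveE _ fcd) (deriveE _ cd) (deriveE _ fd).
by apply: etrans (congr1 (@^~ 1) (diff_comp cd fd)) _.
Qed.

Hypothesis mvi : mean_value_inequality K.

Lemma C1_differentiable n (U : set 'cV[K]_n.+1) (f : 'cV[K]_n.+1 -> K^o) x :
  open U -> U x -> Ck 1 U f -> differentiable f x.
Proof.
move=> Uo Ux [fc /= fk]; apply: differentiable_of_C1 => // [|v].
  by apply: (near_open Uo Ux) => y Uy v; have [+ _] := fk v; apply.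
by have [_ [+ _]] := fk v; apply.
Qed.

Lemma C2_derivable (V W : normedModType K) (U : set V) (f : V -> W) x v w :
  U x -> Ck 2 U f -> derivable ('D_v f) x w.
Proof. by move=> Ux [_ /(_ v)[_ [_ /(_ w)[+ _]]]]; apply. Qed.

Lemma C2_derive_commute (V : normedModType K) (U : set V) (f : V -> K^o) x v w :
  open U -> U x -> Ck 2 U f -> 'D_w ('D_v f) x = 'D_v ('D_w f) x.
Proof.
move=> Uo Ux fk; have [fc fd] := fk.
apply: derive_commute => //.
- apply: (near_open Uo Ux) => y Uy; split.
  + by have [+ _] := fd v; apply.
  + by have [+ _] := fd w; apply.
  + exact: C2_derivable Uy fk.
  + exact: C2_derivable Uy fk.
- by have [_ [_ /(_ w)[_ [+ _]]]] := fd v; apply.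
- by have [_ [_ /(_ v)[_ [+ _]]]] := fd w; apply.
Qed.

End Regularity.

Section Products.
Variables (K : numFieldType) (V : normedModType K).

Lemma is_derive_fsum n (h : 'I_n -> V -> K^o) (dh : 'I_n -> K^o) (x v : V) :
  (forall i, is_derive x v (h i) (dh i)) ->
  is_derive x v (fun y => \sum_i h i y : K^o) (\sum_i dh i).
Proof.
move=> H; have -> : (fun y => \sum_i h i y) = \sum_i h i.
  by apply/funext => y; rewrite fct_sumE.
exact: is_derive_sum.
Qed.

Lemma is_derive_mul (f g : V -> K^o) (df dg : K^o) (x v : V) :
  is_derive x v f df -> is_derive x v g dg ->
  is_derive x v (fun y => f y * g y : K^o) (df * g x + f x * dg).
Proof.
move=> fd gd; apply: is_derive_eq (is_deriveM fd gd) _.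
by rewrite addrC; congr (_ + _); rewrite mulrC.
Qed.

(** Bilinearity in the form of an expansion over the standard basis, in which it
    is used for differentiation. *)
Definition vbasis_sum n m (T : 'cV[K]_n -> 'cV[K]_n -> 'cV[K]_m) :=
  forall a b, T a b = \sum_i \sum_j (a i 0 * b j 0) *: T (delta_mx i 0) (delta_mx j 0).

(** The product rule for a bilinear map that varies with the point too: its
    derivative is taken on the standard basis. *)
Lemma is_derive_bilinear n m (T : V -> 'cV[K]_n.+1 -> 'cV[K]_n.+1 -> 'cV[K]_m.+1)
    (f g : V -> 'cV[K]_n.+1) df dg (dT : 'I_n.+1 -> 'I_n.+1 -> 'cV[K]_m.+1) (x v : V) :
  (\near x, vbasis_sum (T x)) ->
  is_derive x v f df -> is_derive x v g dg ->
  (forall i j, is_derive x v (fun y => T y (delta_mx i 0) (delta_mx j 0)) (dT i j)) ->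
  is_derive x v (fun y => T y (f y) (g y))
    (\sum_i \sum_j (f x i 0 * g x j 0) *: dT i j + T x df (g x) + T x (f x) dg).
Proof.
move=> Tb fd gd Td.
have Tx := nbhs_singleton Tb.
rewrite (Tx df) (Tx (f x)) -!big_split /=.
under [X in is_derive _ _ _ X]eq_bigr do rewrite -!big_split /=.
pose S y := \sum_i \sum_j (f y i 0 * g y j 0) *: T y (delta_mx i 0) (delta_mx j 0).
apply: (@near_eq_is_derive _ _ _ S).
  by apply: filterS Tb => y Ty; rewrite Ty.
apply/is_derive_mx => k l; rewrite summxE.
have -> : (fun y => S y k l : K^o) = (fun y => \sum_i \sum_j
    f y i 0 * g y j 0 * T y (delta_mx i 0) (delta_mx j 0) k l).
  apply/funext => y; rewrite /S summxE; apply: eq_bigr => i _.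
  by rewrite summxE; apply: eq_bigr => j _; rewrite mxE.
apply: is_derive_fsum => i; rewrite summxE; apply: is_derive_fsum => j.
have /is_derive_mx/(_ i 0) fi := fd; have /is_derive_mx/(_ j 0) gj := gd.
have /is_derive_mx/(_ k l) Tij := Td i j.
apply: is_derive_eq (is_derive_mul (is_derive_mul fi gj) Tij) _.
by rewrite !mxE; ring.
Qed.

Lemma derivable_fprod (I : Type) (r : seq I) (h : I -> V -> K^o) (x v : V) :
  (forall i, derivable (h i) x v) ->
  derivable (fun y => \prod_(i <- r) h i y : K^o) x v.
Proof.
move=> H; elim: r => [|i r IH].
  by under eq_fun do rewrite big_nil; exact: derivable_cst.
under eq_fun do rewrite big_cons.
by have [+ _] := is_derive_mul (derivableP (H i)) (derivableP IH).
Qed.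

Lemma derivable_det n (M : V -> 'M[K]_n) (x v : V) :
  (forall i j, derivable (fun y => M y i j : K^o) x v) ->
  derivable (fun y => \det (M y) : K^o) x v.
Proof.
move=> H; rewrite /determinant.
elim: (index_enum _) => [|s r IH].
  by under eq_fun do rewrite big_nil; exact: derivable_cst.
under eq_fun do rewrite big_cons.
apply: derivableD => //.
by have [+ _] := is_derive_mul (is_derive_cst ((-1) ^+ perm.odd_perm s : K^o) x v)
  (derivableP (@derivable_fprod _ (index_enum _)
    (fun i y => M y i (perm.fun_of_perm s i)) x v (fun i => H i (perm.fun_of_perm s i)))).
Qed.

(** By the formula with the adjugate, the entries are rational functions of the
    entries of [M]. *)
Lemma derivable_invmx n (M : V -> 'M[K]_n.+1) (x v : V) :
  (\near x, M x \in unitmx) ->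
  (forall i j, derivable (fun y => M y i j : K^o) x v) ->
  forall i j, derivable (fun y => invmx (M y) i j : K^o) x v.
Proof.
move=> Mu Md i j.
pose f y : K^o := (\det (M y))^-1 * ((-1) ^+ (j + i) * \det (row' j (col' i (M y)))).
apply: (@near_eq_derivable _ _ _ f).
  by apply: filterS Mu => y My; rewrite /invmx My !mxE /cofactor.
have d0 : \det (M x) != 0 by have := nbhs_singleton Mu; rewrite unitmxE unitfE.
have d1 := @derivableV K V (fun y => \det (M y) : K^o) x v d0 (derivable_det Md).
have d2 : derivable (fun y => \det (row' j (col' i (M y))) : K^o) x v.
  by apply: derivable_det => k l; under eq_fun do rewrite !mxE; exact: Md.
have [+ _] := is_derive_mul (is_derive_cst ((-1) ^+ (j + i) : K^o) x v) (derivableP d2).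
by move=> d3; have [+ _] := is_derive_mul (derivableP d1) (derivableP d3).
Qed.

End Products.

Section MatrixCalculus.
Variables (K : numFieldType) (V : normedModType K).

Lemma is_derive_lsum (W : normedModType K) (I : Type) (r : seq I) (h : I -> V -> W)
    (dh : I -> W) (x v : V) :
  (forall i, is_derive x v (h i) (dh i)) ->
  is_derive x v (fun y => \sum_(i <- r) h i y) (\sum_(i <- r) dh i).
Proof.
move=> H; elim: r => [|i r IH].
  by rewrite big_nil; under eq_fun do rewrite big_nil; exact: is_derive_cst.
rewrite big_cons; under eq_fun do rewrite big_cons.
exact: is_deriveD.
Qed.

Lemma is_derive_mulmx m n p (M : V -> 'M[K]_(m.+1, n.+1)) (N : V -> 'M[K]_(n.+1, p.+1))
    dM dN (x v : V) :
  is_derive x v M dM -> is_derive x v N dN ->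
  is_derive x v (fun y => M y *m N y) (dM *m N x + M x *m dN).
Proof.
move=> /is_derive_mx Md /is_derive_mx Nd; apply/is_derive_mx => i j.
rewrite !mxE -big_split /=.
have -> : (fun y => (M y *m N y) i j : K^o) = (fun y => \sum_k M y i k * N y k j : K^o).
  by apply/funext => y; rewrite mxE.
by apply: is_derive_fsum => k; apply: is_derive_mul.
Qed.

Lemma is_derive_unique (W : normedModType K) (f : V -> W) (x v : V) d d' :
  is_derive x v f d -> is_derive x v f d' -> d = d'.
Proof. by move=> [_ <-] [_ <-]. Qed.

Hypothesis mvi : mean_value_inequality K.

Lemma C1_derivable (W W' : normedModType K) (U : set W) (f : W -> W') x v :
  U x -> Ck 1 U f -> derivable f x v.
Proof. by move=> Ux [_ /(_ v)[+ _]]; apply. Qed.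

Lemma is_derive_comp_mx n m p (U : set 'cV[K]_n.+1) (tau : V -> 'cV[K]_n.+1)
    (M : 'cV[K]_n.+1 -> 'M[K]_(m.+1, p.+1)) (x v : V) :
  open U -> U (tau x) -> Ck 1 U M -> derivable tau x v ->
  is_derive x v (fun y => M (tau y)) ('D_('D_v tau x) M (tau x)).
Proof.
move=> Uo Ux Mk taud; apply/is_derive_mx => i j.
have Mij : Ck 1 U (fun y => M y i j : K^o) by exact: Ck_entry.
have dM : differentiable (fun y => M y i j : K^o) (tau x) by apply: C1_differentiable Mij.
have := is_derive_chain taud dM.
have Md : derivable M (tau x) ('D_v tau x) by apply: C1_derivable Mk.
by have /is_derive_mx/(_ i j)[_ <-] := derivableP Md.
Qed.

Lemma C2_derive_commute_mx m p (U : set V) (M : V -> 'M[K]_(m.+1, p.+1)) x v w :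
  open U -> U x -> Ck 2 U M -> 'D_w ('D_v M) x = 'D_v ('D_w M) x.
Proof.
move=> Uo Ux Mk; apply/matrixP => i j.
have E v' w' : 'D_w' ('D_v' M) x i j = 'D_w' ('D_v' (fun y => M y i j : K^o)) x.
  have Md2 : derivable ('D_v' M) x w' by apply: C2_derivable Mk.
  have /is_derive_mx/(_ i j)[_ <-] := derivableP Md2.
  apply: near_eq_derive; apply: (near_open Uo Ux) => y Uy.
  have Mk1 : Ck 1 U M by exact: CkW Mk.
  have Md1 : derivable M y v' by apply: C1_derivable Mk1.
  by have /is_derive_mx/(_ i j)[_ <-] := derivableP Md1.
have Mij : Ck 2 U (fun y => M y i j : K^o) by exact: Ck_entry.
apply: etrans (E v w) (etrans _ (esym (E w v))).
exact: (C2_derive_commute mvi v w Uo Ux Mij).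
Qed.

End MatrixCalculus.

(** * Independence of the curvature from the chart *)

Section Charts.
Variables (K : numFieldType) (M : topologicalType) (n : nat).

Lemma chart_image_open (c : chart K M n) (A : set M) :
  open A -> open (cmap c @` (cdom c `&` A)).
Proof.
move=> Ao; rewrite openE => x [u [cu Au] <-].
have cc : {for cmap c u, continuous (cinv c)}.
  have := @cinv_continuous _ _ _ c; rewrite continuous_open_subspace; last exact: cran_open.
  by apply; rewrite inE; exists u.
have : nbhs (cmap c u) (cinv c @^-1` A).
  by apply: cc; rewrite /= cmapK //; exact: open_nbhs_nbhs.
have : nbhs (cmap c u) (cmap c @` cdom c).
  by apply: open_nbhs_nbhs; split; [exact: cran_open|exists u].
apply: filterS2 => y [w cw <-]; rewrite /= cmapK // => Aw.
by exists w.
Qed.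

End Charts.

Section ChartIndependence.
Variables (K : numFieldType) (r2 : K) (C : cartan_geometry r2).
Hypothesis mvi : mean_value_inequality K.
Local Notation g := 'cV[K]_14.
Local Notation chart14 := (chart K (total_space C) 14).

(** The Cartan connection read in the chart [c]. *)
Definition conn (c : chart14) (x : g) : 'M[K]_14 := omega c (cinv c x).

Lemma conn_Ck k (c : chart14) u : atlas c -> cdom c u ->
  exists U : set g, [/\ open U, U (cmap c u), U `<=` cmap c @` cdom c & Ck k U (conn c)].
Proof.
move=> ac cu; apply: smooth_on_Ck; [exact: cran_open|by exists u|exact: omega_smooth].
Qed.

Lemma d_omegaE (c : chart14) u v w : atlas c -> cdom c u ->
  d_omega c u v w = 'D_v (conn c) (cmap c u) *m w - 'D_w (conn c) (cmap c u) *m v.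
Proof.
move=> ac cu; have [U [Uo Ux _ Uk]] := conn_Ck 1 ac cu.
have D (a b : g) : 'D_a (fun x => omega c (cinv c x) *m b) (cmap c u) = 'D_a (conn c) (cmap c u) *m b.
  have cd : derivable (conn c) (cmap c u) a by apply: C1_derivable Uk.
  have [_ ->] := is_derive_mulmx (derivableP cd) (is_derive_cst b (cmap c u) a).
  by rewrite mulmx0 addr0.
by rewrite /d_omega (D v w) (D w v).
Qed.

(** The exterior derivative commutes with pull-back by the transition map.  The
    constant coordinate fields of one chart are not constant in the other, and
    the resulting terms are second derivatives of the transition map, which
    cancel by symmetry. *)
Lemma d_omega_transition (c c' : chart14) u v w :
  atlas c -> atlas c' -> cdom c u -> cdom c' u ->
  let tau := cmap c' \o cinv c in
  d_omega c u v w = d_omega c' u ('D_v tau (cmap c u)) ('D_w tau (cmap c u)).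
Proof.
move=> ac ac' cu c'u tau.
pose S := cmap c @` (cdom c `&` cdom c').
have So : open S by apply: chart_image_open; exact: cdom_open.
have Su : S (cmap c u) by exists u.
have [U [Uo Ux US Uk]] := smooth_on_Ck 2 So Su (atlas_compat ac ac').
have [U' [U'o U'x _ U'k]] := conn_Ck 1 ac' c'u.
have tauu : tau (cmap c u) = cmap c' u by rewrite /tau /= cmapK.
set x0 := cmap c u in Ux tauu *.
have U1 : Ck 1 U tau by exact: CkW Uk.
rewrite (d_omegaE _ _ ac cu) (d_omegaE _ _ ac' c'u) -/x0 -tauu.
have connE (x a : g) : U x -> conn c x *m a = conn c' (tau x) *m 'D_a tau x.
  move=> /US[p [cp c'p] <-]; rewrite /conn /tau /= cmapK // cmapK //.
  by rewrite omega_chart.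
have [V [Vo Vx _ Vk]] := conn_Ck 1 ac cu.
have D (a b : g) : 'D_a (conn c) x0 *m b =
    'D_('D_a tau x0) (conn c') (tau x0) *m 'D_b tau x0 + conn c' (tau x0) *m 'D_a ('D_b tau) x0.
  have cd : derivable (conn c) x0 a by apply: C1_derivable Vk.
  have := is_derive_mulmx (derivableP cd) (is_derive_cst b x0 a).
  rewrite mulmx0 addr0 => /is_derive_unique; apply.
  apply: (@near_eq_is_derive _ _ _ (fun x => conn c' (tau x) *m 'D_b tau x)).
    by apply: (near_open Uo Ux) => x Ux'; rewrite connE.
  have taud : derivable tau x0 a by apply: C1_derivable U1.
  have tau2 : derivable ('D_b tau) x0 a by apply: C2_derivable Uk.
  apply: is_derive_mulmx; last exact: derivableP.
  by apply: (is_derive_comp_mx mvi U'o _ U'k taud); rewrite tauu.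
have DD : 'D_v ('D_w tau) x0 = 'D_w ('D_v tau) x0.
  exact: (C2_derive_commute_mx mvi w v Uo Ux Uk).
rewrite (D v w) (D w v) DD.
by rewrite opprD addrACA subrr addr0.
Qed.

(** The curvature function computed in a chart that stays fixed while the point
    varies, as is needed to differentiate it. *)
Definition kappa_in (c : chart14) (u : total_space C) : cochain2 K := fun x y =>
  curvature c u (invmx (omega c u) *m x) (invmx (omega c u) *m y).

Lemma kappa_inE (c : chart14) u : atlas c -> cdom c u -> kappa_in c u = kappa u.
Proof.
move=> ac cu; apply/funext => x; apply/funext => y.
have ac' := chart_at_atlas u; have c'u := chart_at_dom u.
rewrite /kappa; set c' : chart14 := chart_at u in ac' c'u *.
have tauE z : 'D_(invmx (omega c u) *m z) (cmap c' \o cinv c) (cmap c u) = invmx (omega c' u) *m z.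
  have := omega_chart ac ac' (invmx (omega c u) *m z) cu c'u.
  rewrite (mulKVmx (omega_iso ac cu)) => zE.
  by rewrite -[in RHS]zE (mulKmx (omega_iso ac' c'u)).
rewrite /kappa_in /curvature (d_omega_transition _ _ ac ac' cu c'u) !tauE.
by rewrite !(mulKVmx (omega_iso ac cu)) !(mulKVmx (omega_iso ac' c'u)).
Qed.

End ChartIndependence.

(** * The Bianchi identity *)

Section Bianchi.
Variables (K : numFieldType) (r2 : K).
Hypothesis r2_sqr : r2 ^+ 2 = 2.
Local Notation g := 'cV[K]_14.
Local Notation "[ x , y ]" := (bracket r2 x y) (at level 0, x, y at level 200).
Local Notation bas := (@bas K).

Lemma bilinear_vbasis_sum (T : cochain2 K) : bilinear_cochain T -> vbasis_sum T.
Proof.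
move=> [lr ll] a b.
pose f y : {linear g -> g} := HB.pack (T^~ y) (GRing.isLinear.Build _ _ _ _ _ (ll y)).
pose h x : {linear g -> g} := HB.pack (T x) (GRing.isLinear.Build _ _ _ _ _ (lr x)).
have E (z : g) : z = \sum_i z i 0 *: delta_mx i 0.
  by rewrite {1}[z]matrix_sum_delta; apply: eq_bigr => i _; rewrite big_ord1.
rewrite {1}(E a) -[LHS]/(f b _) linear_sum; apply: eq_bigr => i _.
rewrite linearZ /= {1}(E b) -[T _ _]/(h (delta_mx i 0) _) linear_sum scaler_sumr.
by apply: eq_bigr => j _; rewrite linearZ scalerA.
Qed.

Lemma bracket_bilinear : @bilinear_cochain K (bracket r2).
Proof.
split=> [x|y] a z z'; first exact: linearP.
by rewrite bracketDl bracketZl.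
Qed.

Lemma horizontal_bilinear (phi : cochain2 K) : horizontal phi -> @bilinear_cochain K phi.
Proof.
move=> hphi; split=> [x|y]; first exact: horizontal_linear.
move=> a z z'; rewrite !(horizontal_antisym hphi _ y) (horizontal_linear hphi) opprD.
by rewrite scalerN.
Qed.

Lemma is_derive_bracket (V : normedModType K) (f h : V -> g) df dh (x v : V) :
  is_derive x v f df -> is_derive x v h dh ->
  is_derive x v (fun y => [f y, h y]) ([df, h x] + [f x, dh]).
Proof.
move=> fd hd.
have := @is_derive_bilinear K V 13 13 (fun _ => bracket r2) f h df dh (fun _ _ => 0) x v.
rewrite big1 ?add0r; last first.
  by move=> i _; rewrite big1 // => j _; rewrite scaler0.
move=> H; apply: (H _ fd hd).
by apply: filterE => y; apply: bilinear_vbasis_sum; exact: bracket_bilinear.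
Qed.

(** The algebra behind the Bianchi identity.  Here X with the indices u and v is
    the derivative along u of the connection applied to v, the d_i and e_i are
    second derivatives in either order, and d with an index is the derivative of
    the curvature function.  Substituting the structure equation into the
    derived ones, the terms with X cancel in the cyclic sum by antisymmetry and
    the double brackets by the Jacobi identity. *)
Lemma bianchi_algebra (br kk : g -> g -> g) (dabc dbca dcab : g)
    (a b c d1 d2 d3 e1 e2 e3 Xuv Xvu Xuw Xwu Xvw Xwv : g) :
  (forall x y, br x y = - br y x) -> (forall x y z, br x (y + z) = br x y + br x z) ->
  (forall x y, kk x y = - kk y x) -> (forall x y z, kk (y + z) x = kk y x + kk z x) ->
  d1 = e1 -> d2 = e2 -> d3 = e3 ->
  br a (br b c) + br b (br c a) + br c (br a b) = 0 ->
  Xuv - Xvu + br a b = kk a b -> Xvw - Xwv + br b c = kk b c ->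
  Xwu - Xuw + br c a = kk c a ->
  d1 - e3 + (br Xuv c + br b Xuw) = dabc + kk Xuv c + kk b Xuw ->
  d2 - e1 + (br Xvw a + br c Xvu) = dbca + kk Xvw a + kk c Xvu ->
  d3 - e2 + (br Xwu b + br a Xwv) = dcab + kk Xwu b + kk a Xwv ->
  (br a (kk b c) - kk (br a b) c + kk (kk a b) c + dabc) +
  (br b (kk c a) - kk (br b c) a + kk (kk b c) a + dbca) +
  (br c (kk a b) - kk (br c a) b + kk (kk c a) b + dcab) = 0.
Proof.
move=> brC brD kC kD -> -> -> jac <- <- <-.
have dE (l d p q : g) : l = d + p + q -> d = l - q - p by move=> ->; rewrite addrK addrK.
move=> /dE -> /dE -> /dE ->.
have br0 x : br x 0 = 0 by apply: (addrI (br x 0)); rewrite -brD !addr0.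
have k0 x : kk 0 x = 0 by apply: (addrI (kk 0 x)); rewrite -kD !addr0.
have brN x y : br x (- y) = - br x y.
  by apply: (addrI (br x y)); rewrite -brD !subrr br0.
have kN x y : kk (- y) x = - kk y x.
  by apply: (addrI (kk y x)); rewrite -kD !subrr k0.
rewrite !brD !kD !brN !kN.
rewrite (brC Xuv c) (brC Xvw a) (brC Xwu b) (kC b Xuw) (kC c Xvu) (kC a Xwv).
have -> : br a (br b c) = - br b (br c a) - br c (br a b).
  by apply/eqP; rewrite -subr_eq0 opprD !opprK addrA; apply/eqP.
by apply/colP => i; rewrite !mxE; ring.
Qed.

Section Local.
Variables (Om : g -> 'M[K]_14) (U : set g) (k : g -> cochain2 K).
Hypothesis mvi : mean_value_inequality K.
Hypothesis Uo : open U.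
Hypothesis Om_C2 : Ck 2 U Om.
Hypothesis Om_unit : forall x, U x -> Om x \in unitmx.
Hypothesis k_normal : forall x, U x -> normal r2 (k x).

(** The curvature of a connection form [Om] on an open subset of g, on constant
    vector fields. *)
Definition curv (x v w : g) : g :=
  'D_v Om x *m w - 'D_w Om x *m v + [Om x *m v, Om x *m w].

Hypothesis curvE : forall x v w, U x -> curv x v w = k x (Om x *m v) (Om x *m w).

Let C1 : Ck 1 U Om. Proof. exact: CkW Om_C2. Qed.

Lemma is_derive_Om x v : U x -> is_derive x v Om ('D_v Om x).
Proof. by move=> Ux; apply: derivableP; apply: C1_derivable C1. Qed.

Lemma is_derive_DOm x v w : U x -> is_derive x w ('D_v Om) ('D_w ('D_v Om) x).
Proof. by move=> Ux; apply: derivableP; apply: C2_derivable Om_C2. Qed.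

Lemma is_derive_mul_const m n (M : g -> 'M[K]_(m.+1, n.+1)) dM (b : 'cV[K]_n.+1) x v :
  is_derive x v M dM -> is_derive x v (fun y => M y *m b) (dM *m b).
Proof.
move=> Md; have := is_derive_mulmx Md (is_derive_cst b x v).
by rewrite mulmx0 addr0.
Qed.

Lemma is_derive_curv x u v w : U x ->
  is_derive x u (fun y => curv y v w)
    ('D_u ('D_v Om) x *m w - 'D_u ('D_w Om) x *m v +
     ([('D_u Om x *m v), (Om x *m w)] + [(Om x *m v), ('D_u Om x *m w)])).
Proof.
move=> Ux; apply: is_deriveD.
  by apply: is_deriveB; apply: is_derive_mul_const; exact: is_derive_DOm.
by apply: is_derive_bracket; apply: is_derive_mul_const; exact: is_derive_Om.
Qed.

Lemma curv_bilinear x : U x -> bilinear_cochain (curv x).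
Proof.
move=> Ux; have [hk _ _] := k_normal Ux; have [lr ll] := horizontal_bilinear hk.
split=> [y|y] a z z'; rewrite !curvE // mulmxDr -scalemxAr.
  exact: lr.
exact: ll.
Qed.

(** The curvature function is obtained from the curvature form by applying the
    inverse of [Om] to its arguments, and all of these are differentiable. *)
Lemma is_derive_k x u a b : U x ->
  is_derive x u (fun y => k y a b) ('D_u (fun y => k y a b) x).
Proof.
move=> Ux; apply: derivableP.
apply: (@near_eq_derivable _ _ _ (fun y => curv y (invmx (Om y) *m a) (invmx (Om y) *m b))).
  by apply: (near_open Uo Ux) => y Uy; rewrite curvE // !mulKVmx //; exact: Om_unit.
have invd (c : g) : derivable (fun y => invmx (Om y) *m c) x u.
  have : derivable (fun y => invmx (Om y)) x u.
    pose D : 'M[K]_14 := \matrix_(i, j) 'D_u (fun y => invmx (Om y) i j : K^o) x.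
    suff : is_derive x u (fun y => invmx (Om y)) D by case.
    apply/is_derive_mx => i j; rewrite mxE; apply: derivableP.
    apply: derivable_invmx => [|p q].
      by apply: (near_open Uo Ux) => y Uy; exact: Om_unit.
    by have /is_derive_mx/(_ p q)[] := is_derive_Om u Ux.
  by move=> /derivableP cd; have [] := is_derive_mul_const c cd.
have near_curv : \near x, vbasis_sum (curv x).
  apply: (near_open Uo Ux) => y Uy.
  by apply: bilinear_vbasis_sum; exact: curv_bilinear.
by have [] := @is_derive_bilinear K g 13 13 curv _ _ _ _ _ x u near_curv
  (derivableP (invd a)) (derivableP (invd b)) (fun i j => is_derive_curv u _ _ Ux).
Qed.

Definition dk (x u : g) : cochain2 K := fun a b => 'D_u (fun y => k y a b) x.

Lemma is_derive_k_args x u (f h : g -> g) df dh : U x ->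
  is_derive x u f df -> is_derive x u h dh ->
  is_derive x u (fun y => k y (f y) (h y)) (dk x u (f x) (h x) + k x df (h x) + k x (f x) dh).
Proof.
move=> Ux fd hd.
have near_k : \near x, vbasis_sum (k x).
  apply: (near_open Uo Ux) => y Uy; apply: bilinear_vbasis_sum.
  by have [/horizontal_bilinear] := k_normal Uy.
have kd i j := is_derive_k u (delta_mx i 0) (delta_mx j 0) Ux.
have [/horizontal_bilinear[lr ll] _ _] := k_normal Ux.
have k0r a : k x a 0 = 0.
  by have := lr a (-1) 0 0; rewrite scaler0 addr0 scaleN1r addNr.
have k0l a : k x 0 a = 0.
  by have := ll a (-1) 0 0; rewrite scaler0 addr0 scaleN1r addNr.
(* For constant arguments the product rule identifies its sum over the basis with
   the derivative of [k] itself. *)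
have := @is_derive_bilinear K g 13 13 k _ _ _ _ _ x u near_k
  (is_derive_cst (f x) x u) (is_derive_cst (h x) x u) kd.
rewrite k0r k0l !addr0 => dE.
have := @is_derive_bilinear K g 13 13 k _ _ _ _ _ x u near_k fd hd kd.
by rewrite /dk (is_derive_unique (is_derive_k u (f x) (h x) Ux) dE).
Qed.

(** The structure equation differentiated along constant fields; the left-hand
    side is the derivative of d omega + 1/2 [omega, omega], the right-hand side
    that of the curvature function applied to omega. *)
Lemma derive_curvature_equation x u v w : U x ->
  'D_u ('D_v Om) x *m w - 'D_u ('D_w Om) x *m v +
    ([('D_u Om x *m v), (Om x *m w)] + [(Om x *m v), ('D_u Om x *m w)]) =
  dk x u (Om x *m v) (Om x *m w) + k x ('D_u Om x *m v) (Om x *m w) +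
    k x (Om x *m v) ('D_u Om x *m w).
Proof.
move=> Ux; apply: is_derive_unique (is_derive_curv u v w Ux) _.
apply: (@near_eq_is_derive _ _ _ (fun y => k y (Om y *m v) (Om y *m w))).
  by apply: (near_open Uo Ux) => y Uy; rewrite curvE.
by apply: is_derive_k_args => //; apply: is_derive_mul_const; exact: is_derive_Om.
Qed.

(** The derived structure equation is taken on the fields whose values under
    [Om] at [x] are a, b, c, and summed cyclically. *)
Lemma bianchi_identity x a b c : U x ->
  let T a b c := [a, k x b c] - k x [a, b] c + k x (k x a b) c + dk x (invmx (Om x) *m a) b c in
  T a b c + T b c a + T c a b = 0.
Proof.
move=> Ux T; rewrite {}/T.
have Omx := Om_unit Ux.
move: (mulKVmx Omx a) (mulKVmx Omx b) (mulKVmx Omx c).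
move: (invmx _ *m a) (invmx _ *m b) (invmx _ *m c) => u v w ua vb wc.
have [hk _ _] := k_normal Ux; have [_ kl] := horizontal_bilinear hk.
have kD z y y' : k x (y + y') z = k x y z + k x y' z.
  by rewrite -{1}[y]scale1r kl scale1r.
have kC := horizontal_antisym hk.
have swap p q (r : g) : 'D_p ('D_q Om) x *m r = 'D_q ('D_p Om) x *m r.
  by rewrite (C2_derive_commute_mx mvi q p Uo Ux Om_C2).
(* From here on the fields u, v, w are the data, and a, b, c their values under [Om]. *)
subst a b c.
exact: (bianchi_algebra (@bracketC K r2) (fun p => linearD (bracket r2 p)) kC kD
  (swap u v w) (swap v w u) (swap w u v) (jacobi r2_sqr _ _ _)
  (curvE u v Ux) (curvE v w Ux) (curvE w u Ux)
  (derive_curvature_equation u v w Ux) (derive_curvature_equation v w u Ux)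
  (derive_curvature_equation w u v Ux)).
Qed.

End Local.
End Bianchi.

(** * The induction on the degree *)

(** Horizontality, positivity and the equations of the span are linear equations
    with constant coefficients; holding on an open set, they pass to
    derivatives. *)
Section DerivativeOfCochains.
Variables (K : numFieldType) (k : 'cV[K]_14 -> cochain2 K) (U : set 'cV[K]_14).
Local Notation g := 'cV[K]_14.
Local Notation bas := (@bas K).
Variables (x u : g).
Hypothesis Uo : open U.
Hypothesis Ux : U x.
Hypothesis kd : forall a b, is_derive x u (fun y => k y a b) (dk k x u a b).

Lemma is_derive_scale_const (h : g -> g) dh c :
  is_derive x u h dh -> is_derive x u (fun y => c *: h y) (c *: dh).
Proof. exact: is_deriveZ. Qed.

Lemma dk_horizontal : (forall y, U y -> horizontal (k y)) -> horizontal (dk k x u).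
Proof.
move=> hk a b; apply: is_derive_unique (kd a b) _.
apply: (@near_eq_is_derive _ _ _ (fun y => \sum_(ij <- neg_pairs)
    (co a ij.1 * co b ij.2 - co a ij.2 * co b ij.1) *: k y (bas ij.1) (bas ij.2))).
  by apply: (near_open Uo Ux) => y Uy; rewrite -hk.
by apply: is_derive_lsum => ij; apply: is_derive_scale_const.
Qed.

Lemma is_derive_co (h : g -> g) dh n : is_derive x u h dh ->
  is_derive x u (fun y => co (h y) n : K^o) (co dh n).
Proof. by move=> /is_derive_mx; apply. Qed.

Lemma dk_positive : (forall y, U y -> positive (k y)) -> positive (dk k x u).
Proof.
move=> pk i j n i14 j14 n14 dijn.
have D := is_derive_co n (kd (bas i) (bas j)).
apply: is_derive_unique D _.
apply: (@near_eq_is_derive _ _ _ (fun=> 0 : K^o)).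
by apply: (near_open Uo Ux) => y Uy; rewrite pk.
Qed.

Lemma dk_in_E l : (forall y, U y -> in_E_below l (k y)) -> in_E_below l (dk k x u).
Proof.
move=> Ek i j n ijn deg.
have D v : is_derive x u (fun y => val2 (k y) v : K^o) (val2 (dk k x u) v).
  by case: v => [|p [|q [|r [|]]]] *; rewrite /=; (exact: is_derive_cst || exact: is_derive_co).
apply: is_derive_unique (D [:: i; j; n]) _; rewrite ev_expand_coef.
apply: (@near_eq_is_derive _ _ _ (fun y => \sum_(b <- Ebasis)
    zK K (coef [:: i; j; n] b) *: (val2 (k y) (head (Z0, [::]) b).2 : K^o))).
  by apply: (near_open Uo Ux) => y Uy; rewrite /= Ek // ev_expand_coef.
apply: is_derive_lsum => b; exact: is_deriveZ.
Qed.

End DerivativeOfCochains.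

Section Main.
Variables (K : numFieldType) (r2 : K).
Hypothesis r2_sqr : r2 ^+ 2 = 2.
Hypothesis mvi : mean_value_inequality K.
Variable C : cartan_geometry r2.
Hypothesis hC : regular_normal C.
Local Notation g := 'cV[K]_14.
Local Notation bas := (@bas K).

Lemma kappa_normal u : normal r2 (@kappa _ _ C u).
Proof. exact: (normal_ker1 r2_sqr (hC u)). Qed.

(** In a fixed chart around [u] the curvature function satisfies the hypotheses
    of [in_E_step]: the induction hypothesis is assumed at all points of the
    bundle, so it applies on a neighbourhood and hence to derivatives. *)
Lemma kappa_step l (u : total_space C) : check_step l ->
  (forall u : total_space C, in_E_below l (kappa u)) ->
  in_E_below (Z.succ l) (kappa u).
Proof.
move=> chk IH.
have ac := chart_at_atlas u; have cu := chart_at_dom u.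
set c := chart_at u in ac cu.
have [U [Uo Ux UI U2]] := conn_Ck 2 ac cu.
pose k x := kappa_in c (cinv c x).
have kE x : U x -> exists2 p : total_space C, cdom c p & k x = kappa p /\ cmap c p = x /\ cinv c x = p.
  move=> /UI[p cp <-]; exists p; first exact: cp.
  by rewrite /k (cmapK cp); split; [exact: (kappa_inE mvi)|].
have Om_unit x : U x -> conn c x \in unitmx.
  by move=> /kE[p cp [_ [_ xp]]]; rewrite /conn xp; apply: omega_iso.
have k_normal x : U x -> normal r2 (k x).
  by move=> /kE[p _ [-> _]]; exact: kappa_normal.
have curvE x v w : U x -> curv r2 (conn c) x v w = k x (conn c x *m v) (conn c x *m w).
  move=> Ux'; have [p cp [_ [px xp]]] := kE _ Ux'.
  rewrite /k /kappa_in /curvature -/(conn c x) !mulKmx ?Om_unit //.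
  by rewrite xp (d_omegaE _ _ ac cp) px.
set x0 := cmap c u in Ux *.
pose dphi n := dk k x0 (invmx (conn c x0) *m bas n).
have kd v a b : is_derive x0 v (fun y => k y a b) (dk k x0 v a b).
  exact: (is_derive_k Uo U2 Om_unit k_normal curvE v a b Ux).
have <- : k x0 = kappa u by rewrite /k cmapK // (kappa_inE mvi).
apply: (@in_E_step _ _ r2_sqr (k x0) dphi l) => //.
- exact: k_normal.
- by move=> n _; apply: (dk_horizontal Uo Ux (kd _)) => y /k_normal[].
- by move=> n _; apply: (dk_positive Uo Ux (kd _)) => y /k_normal[].
- by have [p _ [-> _]] := kE _ Ux; exact: IH.
- move=> n _; apply: (dk_in_E Uo Ux (kd _)) => y /kE[p _ [-> _]]; exact: IH.
- move=> i j n _ _ _.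
  exact: (bianchi_identity r2_sqr mvi Uo U2 Om_unit k_normal curvE (bas i) (bas j) (bas n) Ux).
Qed.

Lemma kappa_in_E (u : total_space C) : in_E_below (Zpos 10) (kappa u).
Proof.
have chk n : n \in iota 1 9 -> check_step (Z.of_nat n).
  move: n; apply/allP; vm_cast_no_check (erefl true).
suff H n : (n < 10)%N -> forall u : total_space C, in_E_below (Z.of_nat n.+1) (kappa u).
  exact: (H 9%N).
elim: n => [|n IH] n10 u'; first exact: (in_E_below1 (kappa_normal u')).
rewrite Nat2Z.inj_succ; apply: kappa_step (chk _ _) (IH (ltnW n10)).
by rewrite mem_iota.
Qed.

End Main.

Local Close Scope classical_set_scope.

Theorem proposition3p4 (R : realType) (K : numFieldType)
    (hK : K = (R : numFieldType) \/ K = (R[i] : numFieldType))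
    (r2 : K) (r2_gt0 : 0 < r2) (r2_sqr : r2 ^+ 2 = 2)
    (C : cartan_geometry r2) (hC : regular_normal C) :
  [/\ forall u : total_space C, curvature_module r2 (kappa u),
      forall (u : total_space C) (x y : 'cV[K]_14), parabolic r2 (kappa u x y)
    & forall (u : total_space C) (x y : 'cV[K]_14),
        filtration r2 (-2) x -> filtration r2 (-2) y -> kappa u x y = 0].
Proof.
have mvi : mean_value_inequality K.
  by case: hK => ->; [exact: mean_value_inequality_real|exact: mean_value_inequality_complex].
have kE := kappa_in_E r2_sqr mvi hC; have kN := kappa_normal r2_sqr hC.
split=> u; first exact: (in_curvature_module r2_sqr (kN u) (kE u)).
  by move=> x y; exact: (torsion_free r2_sqr (kN u) (kE u)).
by move=> x y; exact: (vanish_on_filtration2 r2_sqr (kN u) (kE u)).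
Qed.
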